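(* Let $\mathcal A$, $\mathcal C$ be unital $C^*$-algebras and let $\mathcal B$ be a von Neumann algebra acting on a Hilbert space $\mathcal H$. Let $u:G\to\mathcal U\mathcal B$ and $u':G\to\mathcal U\mathcal C$ be unitary representations of a locally compact group $G$. Let $E$ be a full Hilbert $\mathcal A$-module, let $(G,\eta,E)$ be a dynamical system on $E$, and let $E'$ be a von Neumann $\mathcal C$-$\mathcal B$ module. If $T:E\to E'$ is a $\tau$-map which is $(u',u)$-covariant with respect to $(G,\eta,E)$ and if $\tau:\mathcal A\to\mathcal B$ is completely positive, then there exist: (i) (a) a von Neumann $\mathcal B$-module $F$ with a covariant representation $(\pi,v)$ of $(G,\alpha^{\eta},\mathcal A)$ to $\mathcal B^a(F)$, (b) a map $V\in\mathcal B^a(\mathcal B,F)$ such that (1) $\tau(a)b=V^{*}\pi(a)Vb$ for all $a\in\mathcal A$, $b\in\mathcal B$, (2) $v_tVb=Vu_tb$ for all $t\in G$, $b\in\mathcal B$; (ii) (a) a von Neumann $\mathcal B$-module $F'$ and a covariant quasi-representation $(\Psi,v,w,F,F')$ of $(G,\eta,E)$ such that $\pi$ is associated to $\Psi$, (b) a coisometry $S$ from $E'$ onto $F'$ such that (1) $T(x)b=S^{*}\Psi(x)Vb$ for all $x\in E$, $b\in\mathcal B$, (2) $w_tSy=Su'_ty$ for all $t\in G$, $y\in E'$.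
   Context: Inner products on (pre-)Hilbert $C^*$-modules are conjugate linear in the first variable and linear in the second, with $\langle x,yb\rangle=\langle x,y\rangle b$. A Hilbert $\mathcal A$-module $E$ is full if the closed linear span of $\{\langle x,y\rangle:x,y\in E\}$ is $\mathcal A$. A von Neumann algebra acting on $\mathcal H$ is a strongly closed $C^*$-subalgebra of $\mathcal B(\mathcal H)$ containing the identity operator. A linear map $\tau:\mathcal A\to\mathcal B$ is completely positive if $\sum_{i,j=1}^n b_j^*\tau(a_j^*a_i)b_i\ge 0$ for all $n\in\mathbb N$, $a_1,\dots,a_n\in\mathcal A$, $b_1,\dots,b_n\in\mathcal B$. $\mathcal B^a(E_1,E_2)$ denotes the adjointable maps between (pre-)Hilbert $\mathcal B$-modules, $\mathcal B^a(E_1):=\mathcal B^a(E_1,E_1)$, and $\mathcal B^r(E_1,E_2)$ the bounded right $\mathcal B$-linear maps. $\mathcal U\mathcal B$, $\mathcal U\mathcal C$, $\mathcal U\mathcal B^a(F)$ denote the groups of unitary elements. $\mathcal B$ is regarded as a Hilbert $\mathcal B$-module with $\langle b,c\rangle=b^*c$. The term ''unitary representation of $G$'' (into such a unitary group) is used in its usual sense of a continuous group homomorphism, with no particular topology on the unitary group being specified. Von Neumann modules: for a (pre-)Hilbert $\mathcal B$-module $E$, let $E\odot\mathcal H$ be the interior tensor product (a Hilbert space); each $x\in E$ is identified with $L_x:\mathcal H\to E\odot\mathcal H$, $L_x(h)=x\odot h$. $E$ is a von Neumann $\mathcal B$-module if it is strongly closed in $\mathcal B(\mathcal H,E\odot\mathcal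 H)$. A von Neumann $\mathcal C$-$\mathcal B$ module is a von Neumann $\mathcal B$-module $E'$ with an adjointable left action of $\mathcal C$, i.e. a $*$-homomorphism $\pi':\mathcal C\to\mathcal B^a(E')$; write $cy:=\pi'(c)y$. Dynamical systems: a $C^*$-dynamical system $(G,\alpha,\mathcal A)$ is a group homomorphism $\alpha:G\to Aut(\mathcal A)$ with $t\mapsto\alpha_t(a)$ continuous for each $a\in\mathcal A$. $Aut(E)$ is the group of bijections $\Phi:E\to E$ such that both $\Phi$ and $\Phi^{-1}$ are morphisms of Hilbert $C^*$-modules, where a map $\Phi$ is a morphism if there is a $C^*$-algebra homomorphism $\varphi:\mathcal A\to\mathcal A$ with $\langle\Phi(x),\Phi(y)\rangle=\varphi(\langle x,y\rangle)$ for all $x,y\in E$. A dynamical system $(G,\eta,E)$ on a full Hilbert $\mathcal A$-module $E$ is a group homomorphism $\eta:G\to Aut(E)$ with $t\mapsto\eta_t(x)$ continuous for each $x\in E$. It induces a unique $C^*$-dynamical system $(G,\alpha^\eta,\mathcal A)$ with $\alpha^\eta_t(\langle x,y\rangle)=\langle\eta_t(x),\eta_t(y)\rangle$ for all $x,y\in E$, $t\in G$. $\tau$-maps: $T:E\to E'$ is a $\tau$-map if $\langle T(x),T(y)\rangle=\tau(\langle x,y\rangle)$ for all $x,y\in E$; it is $(u',u)$-covariant with respect to $(G,\eta,E)$ if $T(\eta_t(x))=u'_tT(x)u_t^*$ for all $x\in E$, $t\in G$. Covariant representations: $(\pi,v)$ is a covariant representation of $(G,\alpha,\mathcal A)$ to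 $\mathcal B^a(F)$ if $\pi:\mathcal A\to\mathcal B^a(F)$ is a representation ($*$-homomorphism) and $v:G\to\mathcal U\mathcal B^a(F)$ is a unitary representation with $\pi(\alpha_t(a))=v_t\pi(a)v_t^*$ for all $a\in\mathcal A$, $t\in G$. Quasi-representations: $\Psi:E\to\mathcal B^r(F,F')$ is a quasi-representation of $E$ on $F$ and $F'$ if there is a $*$-homomorphism $\pi:\mathcal A\to\mathcal B^a(F)$ (said to be associated to $\Psi$) with $\langle\Psi(y)f_1,\Psi(x)f_2\rangle=\langle\pi(\langle x,y\rangle)f_1,f_2\rangle$ for all $x,y\in E$, $f_1,f_2\in F$. $(\Psi,v,w,F,F')$ is a covariant quasi-representation of $(G,\eta,E)$ if moreover $v:G\to\mathcal U\mathcal B^a(F)$ and $w:G\to\mathcal U\mathcal B^a(F')$ are unitary representations with $\Psi(\eta_t(x))=w_t\Psi(x)v_t^*$ for all $x\in E$, $t\in G$. A coisometry $S$ from $E'$ onto $F'$ is an adjointable map $S:E'\to F'$ with $SS^*=1_{F'}$. *)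

(* Defs.v *)
From HB Require Import structures.
From mathcomp Require Import all_boot all_order all_algebra.
From mathcomp Require Import complex.
From mathcomp Require Import all_classical all_reals all_analysis.

Set Implicit Arguments.
Unset Strict Implicit.
Unset Printing Implicit Defensive.

Import Order.TTheory GRing.Theory Num.Theory.
Import numFieldNormedType.Exports.

Local Open Scope classical_set_scope.
Local Open Scope ring_scope.

HB.mixin Record isTopologicalGroup G & Group G & Topological G := {
  mulg_continuous : continuous (fun p : G * G => (p.1 * p.2)%g);
  invg_continuous : continuous (fun x : G => (x^-1)%g)
}.

#[short(type="topologicalGroupType")]
HB.structure Definition TopologicalGroup :=
  { G of Group G & Topological G & isTopologicalGroup G }.

Section Span.
Variables (K : numFieldType) (V : lmodType K).

Definition linear_span (S : set V) : set V :=
  [set v | exists n (c : 'I_n -> K) (s : 'I_n -> V),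
     (forall i, S (s i)) /\ v = \sum_(i < n) c i *: s i].

End Span.

Section BoundedOperators.
Variables (K : numFieldType) (U V : normedModType K).

Definition bounded_linear (f : U -> V) :=
  linear f /\ exists M : K, forall x, `|f x| <= M * `|x|.

(* The strong operator topology is the topology of pointwise convergence,
   here restricted to the bounded operators. *)
Definition strongly_closed (S : set (U -> V)) :=
  forall f, bounded_linear f ->
    closure (S : set {ptws U -> V}) f -> S f.

End BoundedOperators.

(* Inner products are conjugate linear in the first variable; norms take their
   values in the nonnegative elements of R[i]. *)
HB.mixin Record isHilbert (R : realType) H & CompleteNormedModule (complex R) H
    := {
  hdot : H -> H -> complex R;
  hdotC : forall x y, hdot y x = (hdot x y)^*;
  hdot_linear : forall x (c : complex R) y z,
    hdot x (c *: y + z) = c * hdot x y + hdot x z;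
  hdot_norm : forall x, hdot x x = `|x| ^+ 2
}.

#[short(type="hilbertType")]
HB.structure Definition Hilbert (R : realType) :=
  { H of CompleteNormedModule (complex R) H & isHilbert R H }.

(* Unital C*-algebras, the zero algebra included. The product is part of the
   mixin because the hierarchy offers no join of normed modules and rings. *)
HB.mixin Record isCStarAlgebra (R : realType) A
    & CompleteNormedModule (complex R) A := {
  cmul : A -> A -> A;
  cone : A;
  star : A -> A;
  cmulA : associative cmul;
  cmul1l : left_id cone cmul;
  cmul1r : right_id cone cmul;
  cmulDl : left_distributive cmul +%R;
  cmulDr : right_distributive cmul +%R;
  cmulZl : forall (c : complex R) (a b : A), cmul (c *: a) b = c *: cmul a b;
  cmulZr : forall (c : complex R) (a b : A), cmul a (c *: b) = c *: cmul a b;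
  starK : involutive star;
  starD : {morph star : a b / a + b};
  starZ : forall (c : complex R) (a : A), star (c *: a) = c^* *: star a;
  starM : forall a b : A, star (cmul a b) = cmul (star b) (star a);
  cstar_normM : forall a b : A, `|cmul a b| <= `|a| * `|b|;
  cstar_norm : forall a : A, `|cmul (star a) a| = `|a| ^+ 2
}.

#[short(type="cstarAlgType")]
HB.structure Definition CStarAlgebra (R : realType) :=
  { A of CompleteNormedModule (complex R) A & isCStarAlgebra R A }.

Notation "a ** b" := (cmul a b) (at level 40, left associativity) : ring_scope.

Section CStarAlgebraTheory.
Variable R : realType.
Implicit Types A D : cstarAlgType R.

Definition positive_elt A (a : A) := exists c : A, a = star c ** c.

Definition unitary_elt A (a : A) := star a ** a = cone /\ a ** star a = cone.

(* Not required to be unital. *)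
Definition star_hom A D (phi : A -> D) :=
  [/\ linear phi,
      {morph phi : a b / a ** b} &
      {morph phi : a / star a}].

Definition completely_positive A D (tau : A -> D) :=
  linear tau /\
  forall n (a : 'I_n -> A) (b : 'I_n -> D),
    positive_elt (\sum_(i < n) \sum_(j < n)
                    star (b j) ** tau (star (a j) ** a i) ** b i).

Definition unitary_hom (G : topologicalGroupType) A (u : G -> A) :=
  (forall t, unitary_elt (u t)) /\ (forall s t, u (s * t)%g = u s ** u t).

End CStarAlgebraTheory.

HB.mixin Record isPreHilbertModule (R : realType) (A : cstarAlgType R) E
    & NormedModule (complex R) E := {
  ract : E -> A -> E;
  ip : E -> E -> A;
  ractDl : forall x y a, ract (x + y) a = ract x a + ract y a;
  ractDr : forall x a b, ract x (a + b) = ract x a + ract x b;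
  ractZl : forall (c : complex R) x a, ract (c *: x) a = c *: ract x a;
  ractZr : forall (c : complex R) x a, ract x (c *: a) = c *: ract x a;
  ractM : forall x a b, ract x (a ** b) = ract (ract x a) b;
  ract1 : forall x, ract x cone = x;
  ip_linear : forall x (c : complex R) y z,
    ip x (c *: y + z) = c *: ip x y + ip x z;
  ip_ract : forall x y a, ip x (ract y a) = ip x y ** a;
  ip_star : forall x y, star (ip x y) = ip y x;
  ip_pos : forall x, positive_elt (ip x x);
  ip_norm : forall x, `|ip x x| = `|x| ^+ 2
}.

#[short(type="preHilbertModType")]
HB.structure Definition PreHilbertModule (R : realType) (A : cstarAlgType R) :=
  { E of NormedModule (complex R) E & isPreHilbertModule R A E }.

#[short(type="hilbertModType")]
HB.structure Definition HilbertModule (R : realType) (A : cstarAlgType R) :=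
  { E of CompleteNormedModule (complex R) E & isPreHilbertModule R A E }.

(* A as a Hilbert A-module, with <a, b> = a^* b. *)
Definition regular_mod (R : realType) (A : cstarAlgType R) : Type := A.

Section RegularModule.
Variables (R : realType) (A : cstarAlgType R).

HB.instance Definition _ :=
  CompleteNormedModule.copy (regular_mod A) (A : completeNormedModType _).

Let ract_ (x : regular_mod A) (a : A) : regular_mod A := (x : A) ** a.
Let ip_ (x y : regular_mod A) : A := star (x : A) ** (y : A).

Let ractDl_ x y a : ract_ (x + y) a = ract_ x a + ract_ y a.
Proof. exact: cmulDl. Qed.
Let ractDr_ x a b : ract_ x (a + b) = ract_ x a + ract_ x b.
Proof. exact: cmulDr. Qed.
Let ractZl_ (c : complex R) x a : ract_ (c *: x) a = c *: ract_ x a.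
Proof. exact: cmulZl. Qed.
Let ractZr_ (c : complex R) x a : ract_ x (c *: a) = c *: ract_ x a.
Proof. exact: cmulZr. Qed.
Let ractM_ x a b : ract_ x (a ** b) = ract_ (ract_ x a) b.
Proof. exact: cmulA. Qed.
Let ract1_ x : ract_ x cone = x.
Proof. exact: cmul1r. Qed.
Let ip_linear_ x (c : complex R) y z :
  ip_ x (c *: y + z) = c *: ip_ x y + ip_ x z.
Proof. by rewrite /ip_ cmulDr cmulZr. Qed.
Let ip_ract_ x y a : ip_ x (ract_ y a) = ip_ x y ** a.
Proof. exact: cmulA. Qed.
Let ip_star_ x y : star (ip_ x y) = ip_ y x.
Proof. by rewrite /ip_ starM starK. Qed.
Let ip_pos_ x : positive_elt (ip_ x x).
Proof. by exists x. Qed.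
Let ip_norm_ x : `|ip_ x x| = `|x| ^+ 2.
Proof. exact: cstar_norm. Qed.

HB.instance Definition _ := @isPreHilbertModule.Build R A (regular_mod A)
  ract_ ip_ ractDl_ ractDr_ ractZl_ ractZr_ ractM_ ract1_
  ip_linear_ ip_ract_ ip_star_ ip_pos_ ip_norm_.

End RegularModule.

Section ModuleMaps.
Variables (R : realType) (A : cstarAlgType R).
Implicit Types E F : preHilbertModType A.

(* Elements of B^a(E, F), bundled with their (unique) adjoint. *)
Record adjointable E F := Adjointable {
  adj_map :> E -> F;
  adj : F -> E;
  adjP : forall x y, ip (adj_map x) y = ip x (adj y)
}.

Definition bounded_rlinear E F (f : E -> F) :=
  bounded_linear f /\ forall x a, f (ract x a) = ract (f x) a.

Definition unitary_adj E (v : adjointable E E) :=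
  (forall x, adj v (v x) = x) /\ (forall x, v (adj v x) = x).

Definition coisometry E F (S : adjointable E F) := forall y, S (adj S y) = y.

Definition star_rep (D : cstarAlgType R) F (pi : D -> adjointable F F) :=
  [/\ forall f, linear (fun a => pi a f),
      forall a b f, pi (a ** b) f = pi a (pi b f) &
      forall a f, pi (star a) f = adj (pi a) f].

Definition full E :=
  closure (linear_span [set a | exists x y : E, a = ip x y]) = [set: A].

Definition module_morphism E (Phi : E -> E) :=
  exists2 phi : A -> A, star_hom phi &
    forall x y, ip (Phi x) (Phi y) = phi (ip x y).

Definition module_automorphism E (Phi : E -> E) :=
  exists Phi' : E -> E,
    [/\ cancel Phi Phi', cancel Phi' Phi,
        module_morphism Phi & module_morphism Phi'].

Definition dynamical_system (G : topologicalGroupType) E (eta : G -> E -> E) :=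
  [/\ forall t, module_automorphism (eta t),
      forall s t x, eta (s * t)%g x = eta s (eta t x) &
      forall x, continuous (fun t => eta t x)].

(* alpha^eta: when E is full, the *-homomorphism implementing eta t on inner
   products is unique. *)
Definition induced_action (G : topologicalGroupType) E (eta : G -> E -> E)
    (t : G) : A -> A :=
  xget (idfun : A -> A) [set phi : A -> A | star_hom phi /\
    forall x y, ip (eta t x) (eta t y) = phi (ip x y)].

Lemma induced_actionP (G : topologicalGroupType) E (eta : G -> E -> E) t :
  dynamical_system eta ->
  star_hom (induced_action eta t) /\
  forall x y, induced_action eta t (ip x y) = ip (eta t x) (eta t y).
Proof.
case=> /(_ t)[_ [_ _ [phi hphi phiE] _]] _ _.
rewrite /induced_action; case: xgetP => [psi _ [hpsi psiE]|/(_ phi)[]//].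
by split=> // x y; rewrite psiE.
Qed.

End ModuleMaps.

(* A von Neumann algebra acting on H: B is identified with a strongly closed
   *-algebra of operators on H through the faithful unital representation
   vna_op. Since an injective *-homomorphism is isometric, the norm of B is the
   operator norm. *)
Record vonNeumannAlgebra (R : realType) (H : hilbertType R) :=
    VonNeumannAlgebra {
  vna_alg :> cstarAlgType R;
  vna_op : vna_alg -> H -> H;
  vna_op_bounded : forall b, bounded_linear (vna_op b);
  vna_op_linear : forall h, linear (fun b => vna_op b h);
  vna_op1 : forall h, vna_op cone h = h;
  vna_opM : forall a b h, vna_op (a ** b) h = vna_op a (vna_op b h);
  vna_op_star : forall b h k, hdot (vna_op (star b) h) k = hdot h (vna_op b k);
  vna_op_inj : injective vna_op;
  vna_closed : strongly_closed (range vna_op)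
}.

Section VonNeumannModules.
Variables (R : realType) (H : hilbertType R) (B : vonNeumannAlgebra H).

(* The interior tensor product of E and H over B, given up to unitary
   equivalence by the inner products of its simple tensors and their totality;
   bilinearity and the relation xb (x) h = x (x) bh are consequences of
   it_dot. *)
Record interiorTensor (E : preHilbertModType B) := InteriorTensor {
  it_space : hilbertType R;
  it_tens : E -> H -> it_space;
  it_dot : forall x y h k,
    hdot (it_tens x h) (it_tens y k) = hdot h (vna_op (ip x y) k);
  it_total : closure (linear_span [set z | exists x h, z = it_tens x h])
             = [set: it_space]
}.

(* it_tens sends x to the operator L_x. *)
Record vonNeumannModule := VonNeumannModule {
  vnm_mod :> preHilbertModType B;
  vnm_tensor : interiorTensor vnm_mod;
  vnm_closed : strongly_closed (range (it_tens vnm_tensor))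
}.

Definition tens (E : vonNeumannModule) (x : E) (h : H) :
    it_space (vnm_tensor E) :=
  it_tens (vnm_tensor E) x h.

End VonNeumannModules.

(* The two topologies for which unitary representations on von Neumann modules
   are considered: the operator norm topology, and the strong operator topology
   of B^a(F) acting on the Hilbert space F (x) H. *)
Inductive unitary_topology := norm_topology | strong_topology.

Section UnitaryRepresentations.
Variables (R : realType) (H : hilbertType R) (B : vonNeumannAlgebra H).
Variable G : topologicalGroupType.
Implicit Types F : vonNeumannModule B.

Definition norm_continuous F (v : G -> F -> F) :=
  forall (s : G) (e : complex R), 0 < e ->
    \forall t \near s, forall f, `|v t f - v s f| <= e * `|f|.

Definition strong_continuous F (v : G -> F -> F) :=
  forall f h, continuous (fun t => tens (v t f) h).

Definition unitary_rep (top : unitary_topology) F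
    (v : G -> adjointable F F) :=
  [/\ forall t, unitary_adj (v t),
      forall s t f, v (s * t)%g f = v s (v t f) &
      match top with
      | norm_topology => norm_continuous v
      | strong_topology => strong_continuous v
      end].

(* Unitary representations into a von Neumann algebra are strongly
   continuous on H. *)
Definition vna_unitary_rep (u : G -> B) :=
  unitary_hom u /\ forall h, continuous (fun t => vna_op (u t) h).

(* Unitary representations into a C*-algebra D, continuous either for the norm
   of D or strongly through a left action of D on F. *)
Definition cstar_unitary_rep (top : unitary_topology) (D : cstarAlgType R) F
    (pi : D -> adjointable F F) (u : G -> D) :=
  unitary_hom u /\
  match top with
  | norm_topology => continuous u
  | strong_topology => strong_continuous (fun t => pi (u t))
  end.

End UnitaryRepresentations.

Section TauMaps.
Variables (R : realType) (H : hilbertType R) (B : vonNeumannAlgebra H).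
Variables (A : cstarAlgType R) (G : topologicalGroupType).
Variables (E : hilbertModType A) (eta : G -> E -> E).

Definition tau_map (F : preHilbertModType B) (tau : A -> B) (T : E -> F) :=
  forall x y, ip (T x) (T y) = tau (ip x y).

Definition covariant_map (C : cstarAlgType R) (F : preHilbertModType B)
    (pi : C -> adjointable F F) (u' : G -> C) (u : G -> B) (T : E -> F) :=
  forall t x, T (eta t x) = ract (pi (u' t) (T x)) (star (u t)).

Definition covariant_rep (top : unitary_topology) (alpha : G -> A -> A)
    (F : vonNeumannModule B) (pi : A -> adjointable F F)
    (v : G -> adjointable F F) :=
  [/\ star_rep pi, unitary_rep top v &
      forall t a f, pi (alpha t a) f = v t (pi a (adj (v t) f))].

Definition associated (F F' : preHilbertModType B) (Psi : E -> F -> F')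
    (pi : A -> adjointable F F) :=
  forall x y f1 f2, ip (Psi y f1) (Psi x f2) = ip (pi (ip x y) f1) f2.

Definition quasi_rep (F F' : preHilbertModType B) (Psi : E -> F -> F') :=
  (forall x, bounded_rlinear (Psi x)) /\
  exists2 pi : A -> adjointable F F, star_rep pi & associated Psi pi.

Definition covariant_quasi_rep (top : unitary_topology)
    (F F' : vonNeumannModule B) (Psi : E -> F -> F')
    (v : G -> adjointable F F) (w : G -> adjointable F' F') :=
  [/\ quasi_rep Psi, unitary_rep top v, unitary_rep top w &
      forall t x f, Psi (eta t x) f = w t (Psi x (adj (v t) f))].

End TauMaps.

(* Main.v *)
(* Since A is unital and E is full, there is a finite frame z_1, ..., z_n in E
   with sum <z_i, z_i> = 1. Replacing E' by M := pi'(1) E', onto which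
   S := pi'(1) is a coisometry, makes the action of C unital. The vectors
   a (x) h with <a (x) h, b (x) k> = <h, tau(a^* b) k> then embed isometrically
   in (M (x) H)^n through a (x) h |-> (T(z_i a) (x) h)_i; this gives positivity
   of the form and a Hilbert space K without forming a completion. On K there are
   Psi(x) : a (x) h |-> T(x a) (x) h with values in M (x) H,
   pi(b) : a (x) h |-> b a (x) h and v_t : a (x) h |-> alpha_t(a) (x) u_t h.
   Take for F the operators X : H -> K such that Psi(x) X lies in M for all x. F is
   strongly closed because M is, and X^* Y = sum (Psi(z_i) X)^* (Psi(z_i) Y) lies
   in B because M is a B-module. As Psi(y) v_t = w_t Psi(eta_t^-1 y) and the
   Psi(z_i) jointly preserve the norm, v inherits the continuity of w, in either
   topology. *)
Require Import Defs.
From HB Require Import structures.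
From mathcomp Require Import all_boot all_order all_algebra.
From mathcomp Require Import complex.
From mathcomp Require Import all_classical all_reals all_analysis.
From mathcomp Require Import ring lra.

Set Implicit Arguments.
Unset Strict Implicit.
Unset Printing Implicit Defensive.

Import Order.TTheory GRing.Theory Num.Theory.
Import numFieldNormedType.Exports.
Local Open Scope classical_set_scope.
Local Open Scope ring_scope.

(** * Real-valued norms and limits *)

(** The algebras are abstract, with the norm identity as the only link between norm and involution,
    so order arguments rest on square roots. That c^* c = r r with [r] selfadjoint is what allows
    the frame to be normalized. Operator bounds come from identities instead of inequalities: c^* c
    <= |c|^2 is used as c^* c + r^2 = |c|^2, where r^2 contributes a defect term to a Gram matrix.
    The module F' is all of M and not the closed span of Psi(E) F: the coisometry only has to map E'
    onto F', and no complement of a submodule has to be found. The formula a (x) h |-> alpha_t(a)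
    (x) u_t h does not give the continuity of v, because [u] is only strongly continuous while norm
    continuity of v may be demanded. The continuity has to come through w, and this is why the norm
    of K is expressed by finitely many Psi(z_i). *)

Lemma ge0_complexRe (R : realType) (z : complex R) : 0 <= z -> z = (complex.Re z)%:C%C.
Proof. by case: z => a b; rewrite lecE /= => /andP[/eqP-> _]. Qed.

Section RealNorm.
Variables (R : realType) (V : normedModType (complex R)).
Implicit Types (x y : V) (c : complex R) (r : R).

(* Norms take their values in R[i]; [nrm] is the same norm with values in R,
   where [lra] and [nra] apply. *)
Definition nrm x : R := complex.Re `|x|.

Lemma nrmE x : `|x| = (nrm x)%:C%C.
Proof. by apply: ge0_complexRe. Qed.

Lemma nrm_ge0 x : 0 <= nrm x.
Proof. by rewrite -ler0c -nrmE. Qed.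

Lemma nrmD x y : nrm (x + y) <= nrm x + nrm y.
Proof. by rewrite -lecR rmorphD /= -!nrmE ler_normD. Qed.

Lemma nrmN x : nrm (- x) = nrm x.
Proof. by rewrite /nrm normrN. Qed.

Lemma nrmB x y : nrm (x - y) <= nrm x + nrm y.
Proof. by rewrite -(nrmN y) nrmD. Qed.

Lemma nrmC x y : nrm (x - y) = nrm (y - x).
Proof. by rewrite -nrmN opprB. Qed.

Lemma nrm0 : nrm 0 = 0.
Proof. by rewrite /nrm normr0. Qed.

Lemma nrm_eq0 x : nrm x = 0 -> x = 0.
Proof. by move=> h; apply/eqP; rewrite -normr_eq0 nrmE h. Qed.

Lemma nrmZ c x : nrm (c *: x) = complex.Re `|c| * nrm x.
Proof.
apply: complexI; rewrite rmorphM /= -!nrmE normrZ.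
by rewrite -(ge0_complexRe (normr_ge0 c)).
Qed.

Lemma nrmZr r x : nrm (r%:C%C *: x) = `|r| * nrm x.
Proof. by rewrite nrmZ normc_def /= expr0n /= addr0 sqrtr_sqr. Qed.

Lemma nrm_sub_trans y x z : nrm (x - z) <= nrm (x - y) + nrm (y - z).
Proof. by rewrite -[x - z](subrKA y) nrmD. Qed.

Lemma nrm_le_eq0 x : (forall e : R, 0 < e -> nrm x <= e) -> x = 0.
Proof.
move=> h; apply: nrm_eq0; apply/eqP; rewrite eq_le nrm_ge0 andbT.
by apply/ler_addgt0Pr => e e0; rewrite add0r h.
Qed.

Lemma closure_nrmP (S : set V) x :
  closure S x <-> forall e : R, 0 < e -> exists2 y, S y & nrm (x - y) < e.
Proof.
split=> [clS e e0|h A].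
  have e0' : 0 < e%:C%C :> complex R by rewrite ltcR.
  have [y [Sy xy]] := clS _ (nbhsx_ballx x _ e0').
  by exists y => //; move: xy; rewrite -ball_normE /= nrmE ltcR.
rewrite -filter_from_ballE => -[e /= e0 eA].
have ee := ge0_complexRe (ltW e0).
have [|y Sy xy] := h (complex.Re e); first by rewrite -ltcR -ee.
by exists y; split => //; apply: eA; rewrite -ball_normE /= ee nrmE ltcR.
Qed.

Lemma near_nrm (T : Type) (F : set_system T) {FF : Filter F} (f : T -> V) x :
  f @ F --> x <-> forall e : R, 0 < e -> \forall t \near F, nrm (x - f t) < e.
Proof.
split=> [/cvgrPdist_lt cf e e0|h].
  have e0' : 0 < e%:C%C :> complex R by rewrite ltcR.
  by apply: filterS (cf _ e0') => t; rewrite nrmE ltcR.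
apply/cvgrPdist_lt => e e0.
have ee := ge0_complexRe (ltW e0).
have e0' : 0 < complex.Re e by rewrite -ltcR -ee.
by apply: filterS (h _ e0') => t; rewrite -ltcR -nrmE -ee.
Qed.

End RealNorm.

Section Completeness.
Variables (R : realType) (V : completeNormedModType (complex R)).

Definition is_limit (U : normedModType (complex R)) (u : nat -> U) (l : U) :=
  forall e : R, 0 < e -> exists N, forall n, (N <= n)%N -> nrm (u n - l) < e.

Lemma complete_limit (u : nat -> V) :
  (forall e : R, 0 < e -> exists N, forall m n,
     (N <= m)%N -> (N <= n)%N -> nrm (u m - u n) < e) ->
  exists l, is_limit u l.
Proof.
move=> cu.
have : cauchy (u @ \oo).
  apply: cauchy_exP => e e0.
  have ee := ge0_complexRe (ltW e0).
  have [|N uN] := cu (complex.Re e); first by rewrite -ltcR -ee.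
  exists (u N), N => // n /= Nn.
  by rewrite -ball_normE /= ee nrmE ltcR uN.
move/cauchy_cvgP => /cvg_ex[l /near_nrm ul]; exists l => e e0.
by have [N _ uN] := ul e e0; exists N => n /uN; rewrite nrmC.
Qed.

(** The increments of [u] are dominated by those of a bounded nondecreasing real sequence, which are
    small near its supremum. Both the iteration for square roots and the Neumann series converge in
    this way. *)
Lemma majorant_limit (u : nat -> V) (r : nat -> R) (M : R) :
  (forall n, r n <= M) ->
  (forall n, nrm (u n.+1 - u n) <= r n.+1 - r n) ->
  exists l, is_limit u l.
Proof.
move=> rM ur; apply: complete_limit => e e0.
have step m k : nrm (u (m + k)%N - u m) <= r (m + k)%N - r m.
  elim: k => [|k IHk]; first by rewrite addn0 !subrr nrm0.
  rewrite addnS; apply: (le_trans (nrm_sub_trans (u (m + k)%N) _ _)).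
  by have := ur (m + k)%N; lra.
have r_ge m n : (m <= n)%N -> r m <= r n.
  move=> /subnKC <-; have := step m (n - m)%N.
  by have := nrm_ge0 (u (m + (n - m))%N - u m); lra.
have hs : has_sup (range r) by split; [exists (r 0%N), 0%N | exists M => _ [n _ <-]].
have [_ [N _ <-] rN] := @sup_adherent _ (range r) (e / 2) ltac:(lra) hs.
have r_sup n : r n <= sup (range r) by apply: sup_upper_bound => //; exists n.
exists N => m n Nm Nn.
apply: (le_lt_trans (nrm_sub_trans (u N) _ _)).
have := step N (m - N)%N; have := step N (n - N)%N.
rewrite !subnKC // (nrmC (u N)) => h1 h2.
by have := r_sup m; have := r_sup n; lra.
Qed.

End Completeness.

Section Limits.
Variables (R : realType) (U : normedModType (complex R)).
Implicit Types (u : nat -> U) (l : U).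

Lemma limit_close u l (e : R) N : is_limit u l -> 0 < e ->
  exists2 n, (N <= n)%N & nrm (u n - l) < e.
Proof.
move=> ul /ul[N' uN']; exists (maxn N N'); first exact: leq_maxl.
by apply: uN'; exact: leq_maxr.
Qed.

Lemma limit_le u l (z : U) (M : R) N : is_limit u l ->
  (forall n, (N <= n)%N -> nrm (u n - z) <= M) -> nrm (l - z) <= M.
Proof.
move=> ul uM; apply/ler_addgt0Pr => e e0.
have [n Nn un] := limit_close N ul e0.
apply: (le_trans (nrm_sub_trans (u n) _ _)).
by have := uM n Nn; rewrite (nrmC l); lra.
Qed.

Lemma limit_le0 u l (M : R) : is_limit u l ->
  (forall n, nrm (u n) <= M) -> nrm l <= M.
Proof.
by move=> ul uM; rewrite -[l]subr0; apply: (limit_le (N := 0) ul) => n; rewrite subr0.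
Qed.

(** Carries identities such as selfadjointness and commutation from the iterates to their limit. A
    Lipschitz bound on the unit ball around [l] takes the place of continuity of [f]. *)
Lemma limit_eq (W : normedModType (complex R)) u l (f : U -> W) (K : R) :
  is_limit u l -> (forall n, f (u n) = 0) ->
  (forall x, nrm (x - l) <= 1 -> nrm (f l - f x) <= K * nrm (x - l)) ->
  f l = 0.
Proof.
move=> ul fu fK; apply: nrm_le_eq0 => e e0.
have K0 : 0 < `|K| + 1 by have := normr_ge0 K; lra.
have d0 : 0 < Num.min 1 (e / (`|K| + 1)).
  by rewrite lt_min ltr01 divr_gt0.
have [n _ ] := limit_close 0 ul d0; rewrite lt_min => /andP[un1 un2].
have := fK _ (ltW un1); rewrite fu subr0 => /le_trans; apply.
have nn := nrm_ge0 (u n - l).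
move: un2; rewrite ltr_pdivlMr // => un2.
by have := ler_norm K; nra.
Qed.

End Limits.

(** * Square roots and positivity in C*-algebras *)

Lemma subBB (V : zmodType) (a b c d : V) : (a - b) - (c - d) = (a - c) - (b - d).
Proof. by rewrite !opprD addrACA. Qed.

Section CStarNorm.
Variables (R : realType) (A : cstarAlgType R).
Implicit Types (a b h p q w : A) (c : complex R) (r : R).

Lemma cmul0l a : 0 ** a = 0 :> A.
Proof. by rewrite -[in LHS](scale0r (0 : A)) cmulZl scale0r. Qed.

Lemma cmul0r a : a ** 0 = 0 :> A.
Proof. by rewrite -[in LHS](scale0r (0 : A)) cmulZr scale0r. Qed.

Lemma cmulNl a b : (- a) ** b = - (a ** b).
Proof. by rewrite -scaleN1r cmulZl scaleN1r. Qed.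

Lemma cmulNr a b : a ** (- b) = - (a ** b).
Proof. by rewrite -scaleN1r cmulZr scaleN1r. Qed.

Lemma cmulBl a b d : (a - b) ** d = a ** d - b ** d.
Proof. by rewrite cmulDl cmulNl. Qed.

Lemma cmulBr a b d : a ** (b - d) = a ** b - a ** d.
Proof. by rewrite cmulDr cmulNr. Qed.

Lemma cmul_suml (I : Type) (s : seq I) (f : I -> A) b :
  (\sum_(i <- s) f i) ** b = \sum_(i <- s) f i ** b.
Proof.
by elim/big_rec2: _ => [|i y z _ <-]; rewrite ?cmul0l ?cmulDl.
Qed.

Lemma cmul_sumr (I : Type) (s : seq I) (f : I -> A) b :
  b ** (\sum_(i <- s) f i) = \sum_(i <- s) b ** f i.
Proof.
by elim/big_rec2: _ => [|i y z _ <-]; rewrite ?cmul0r ?cmulDr.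
Qed.

Lemma star0 : star (0 : A) = 0.
Proof. by rewrite -(scale0r (0 : A)) starZ conjC0 !scale0r. Qed.

Lemma starN a : star (- a) = - star a.
Proof. by rewrite -scaleN1r starZ conjCN1 scaleN1r. Qed.

Lemma starB a b : star (a - b) = star a - star b.
Proof. by rewrite starD starN. Qed.

Lemma star_sum (I : Type) (s : seq I) (f : I -> A) :
  star (\sum_(i <- s) f i) = \sum_(i <- s) star (f i).
Proof. by elim/big_rec2: _ => [|i y z _ <-]; rewrite ?star0 ?starD. Qed.

Lemma star1 : star (cone : A) = cone.
Proof. by have := starM (star cone) (cone : A); rewrite starK !cmul1r starK. Qed.

Lemma conj_real r : (r%:C%C : complex R)^* = r%:C%C.
Proof. by rewrite conj_Creal // complex_real. Qed.

Lemma starZr r a : star (r%:C%C *: a) = r%:C%C *: star a.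
Proof. by rewrite starZ conj_real. Qed.

Lemma nrmM a b : nrm (a ** b) <= nrm a * nrm b.
Proof. by rewrite -lecR rmorphM /= -!nrmE cstar_normM. Qed.

Lemma nrm_cstar a : nrm (star a ** a) = nrm a ^+ 2.
Proof. by apply: complexI; rewrite rmorphXn /= -!nrmE cstar_norm. Qed.

Lemma nrm_star a : nrm (star a) = nrm a.
Proof.
have le_star b : nrm b <= nrm (star b).
  have := nrm_ge0 b; rewrite le_eqVlt => /predU1P[<-|b0]; first exact: nrm_ge0.
  by rewrite -(ler_pM2r b0) -expr2 -nrm_cstar nrmM.
by apply: le_anti; rewrite le_star -{2}(starK a) le_star.
Qed.

Lemma nrm_sa_sq p : star p = p -> nrm (p ** p) = nrm p ^+ 2.
Proof. by move=> sp; rewrite -{1}sp nrm_cstar. Qed.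

Lemma nrm_cone : nrm (cone : A) <= 1.
Proof.
have := nrm_cstar cone; rewrite star1 cmul1l => h.
by have := nrm_ge0 (cone : A); nra.
Qed.

End CStarNorm.

Section Ford.
Variables (R : realType) (A : cstarAlgType R).
Implicit Types (a b h p q w : A) (r : R).

Lemma half_split a : a = (2^-1 : R)%:C%C *: (a + a) :> A.
Proof.
rewrite scalerDr -scalerDl -rmorphD /= -[LHS]scale1r; congr (_ *: _).
by rewrite -(rmorph1 (real_complex R)); congr (_%:C)%C; lra.
Qed.

(* Ford's square root lemma: [w] is the limit of [w' = (h + w^2) / 2], which
   makes it selfadjoint and puts it in the bicommutant of [h]. *)
Lemma ford_sqrt h : star h = h -> nrm h <= 1 ->
  exists w, [/\ star w = w, nrm w <= 1,
    (cone - w) ** (cone - w) = cone - h &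
    forall b, h ** b = b ** h -> w ** b = b ** w].
Proof.
move=> sh h1.
pose u := fix u n := if n is m.+1 then (2^-1 : R)%:C%C *: (h + u m ** u m) else 0.
(* The same recursion for the scalar h = 1. It stays in [0, 1] and majorizes both the norms and the
   increments of [u]. *)
pose r := fix r n : R := if n is m.+1 then (1 + r m ^+ 2) / 2 else 0.
have uS n : u n.+1 = (2^-1 : R)%:C%C *: (h + u n ** u n) by [].
have rS n : r n.+1 = (1 + r n ^+ 2) / 2 by [].
have half0 : `|2^-1 : R| = 2^-1 by rewrite ger0_norm // invr_ge0.
have r01 n : 0 <= r n <= 1.
  by elim: n => [|n IHn]; [rewrite lexx ler01 | rewrite rS; nra].
have ur n : nrm (u n) <= r n.
  elim: n => [|n IHn]; first by rewrite nrm0.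
  rewrite uS rS nrmZr half0.
  have := nrmD h (u n ** u n); have := nrmM (u n) (u n).
  by have := nrm_ge0 (u n); have := r01 n; nra.
have sqB x y : x ** x - y ** y = x ** (x - y) + (x - y) ** y :> A.
  by rewrite cmulBr cmulBl addrA subrK.
have dur n : nrm (u n.+1 - u n) <= r n.+1 - r n.
  elim: n => [|n IHn].
    by rewrite uS rS /= cmul0l addr0 !subr0 nrmZr half0; lra.
  rewrite uS [in X in _ - X]uS -scalerBr nrmZr half0 opprD addrACA subrr add0r sqB.
  rewrite (rS n.+1) [in X in _ <= _ - X]rS.
  have := nrmD (u n.+1 ** (u n.+1 - u n)) ((u n.+1 - u n) ** u n).
  have := nrmM (u n.+1) (u n.+1 - u n); have := nrmM (u n.+1 - u n) (u n).
  have := ur n; have := ur n.+1; have := r01 n; have := r01 n.+1.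
  have := nrm_ge0 (u n); have := nrm_ge0 (u n.+1); have := nrm_ge0 (u n.+1 - u n).
  move: IHn.
  set x := nrm (u n.+1 - u n); set y := nrm (u n.+1); set z := nrm (u n).
  move: (r n.+1) (r n) => s t xst x0 y0 z0 s01 t01 ys zt.
  have : z * x <= t * (s - t) by nra.
  have : y * x <= s * (s - t) by nra.
  by rewrite (mulrC z); lra.
have [w uw] := majorant_limit (M := 1) (fun n => proj2 (andP (r01 n))) dur.
have w1 : nrm w <= 1.
  apply: (limit_le0 uw) => n; apply: (le_trans (ur n)).
  by case/andP: (r01 n).
have u1 n : nrm (u n) <= 1.
  by apply: (le_trans (ur n)); case/andP: (r01 n).
have ww : w = (2^-1 : R)%:C%C *: (h + w ** w).
  apply/eqP; rewrite -subr_eq0; apply/eqP; apply: nrm_le_eq0 => e e0.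
  have [N uN] := uw (e / 2) ltac:(lra).
  apply: (le_trans (nrm_sub_trans (u N.+1) _ _)).
  have := uN N.+1 (leqnSn _); rewrite nrmC => uN1.
  rewrite uS -scalerBr nrmZr half0 opprD addrACA subrr add0r sqB.
  have := nrmD (u N ** (u N - w)) ((u N - w) ** w).
  have := nrmM (u N) (u N - w); have := nrmM (u N - w) w.
  have := uN N (leqnn _); have := u1 N; have := nrm_ge0 (u N).
  by have := nrm_ge0 (u N - w); have := nrm_ge0 w; move: uN1; rewrite uS; nra.
have w2 : w + w = h + w ** w.
  by rewrite [in LHS]ww -scalerDr -half_split.
exists w; split => //.
- apply/eqP; rewrite -subr_eq0; apply/eqP.
  apply: (limit_eq (f := fun x => star x - x) (K := 2) uw).
    elim=> [|n IHn]; first by rewrite star0 subrr.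
    move/eqP: IHn; rewrite subr_eq0 => /eqP IHn.
    by rewrite uS starZr starD starM sh IHn subrr.
  move=> x _; rewrite subBB -starB.
  apply: (le_trans (nrmB _ _)); rewrite nrm_star.
  by rewrite (nrmC w); lra.
- rewrite cmulBl !cmulBr !cmul1l cmul1r.
  by rewrite opprB addrACA -opprD w2 opprD addrACA subrr addr0.
- move=> b hb; apply/eqP; rewrite -subr_eq0; apply/eqP.
  apply: (limit_eq (f := fun x => x ** b - b ** x) (K := 2 * nrm b) uw).
    elim=> [|n IHn]; first by rewrite cmul0l cmul0r subrr.
    move/eqP: IHn; rewrite subr_eq0 => /eqP IHn.
    rewrite uS cmulZl cmulZr cmulDl cmulDr hb -cmulA IHn cmulA IHn -cmulA subrr.
    by [].
  move=> x _; rewrite subBB -cmulBl -cmulBr.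
  apply: (le_trans (nrmB _ _)); rewrite (nrmC x).
  by have := nrmM (w - x) b; have := nrmM b (w - x); lra.
Qed.

(* [p + i q] is a multiple of a unitary. *)
Lemma sum_sq_bound p q r : star p = p -> star q = q -> p ** q = q ** p ->
  p ** p + q ** q = (r ^+ 2)%:C%C *: cone -> 0 <= r -> nrm p <= r.
Proof.
move=> sp sq pq pqr r0; set u := p + 'i *: q.
have su : star u = p - 'i *: q.
  by rewrite starD starZ sp sq conjCi scaleNr.
have uu : star u ** u = (r ^+ 2)%:C%C *: cone.
  rewrite su cmulBl !cmulDr !cmulZl !cmulZr pq scalerA -expr2 sqrCi scaleN1r.
  by rewrite opprD opprK addrA addrK.
have ur : nrm u <= r.
  have := nrm_cstar u; rewrite uu nrmZr ger0_norm ?sqr_ge0 // => ur.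
  rewrite -(@ler_pXn2r _ 2) ?nnegrE ?nrm_ge0 // -ur.
  by have := nrm_cone A; have := sqr_ge0 r; nra.
rewrite (half_split p) nrmZr ger0_norm ?invr_ge0 //.
have -> : p + p = u + star u by rewrite su addrACA subrr addr0.
by have := nrmD u (star u); rewrite nrm_star; lra.
Qed.

Lemma star_sq p : star p = p -> star (p ** p) = p ** p.
Proof. by move=> sp; rewrite starM sp. Qed.

Lemma star_cstar a : star (star a ** a) = star a ** a.
Proof. by rewrite starM starK. Qed.

Lemma sub_cone_sa p : star p = p -> star (cone - p) = cone - p.
Proof. by move=> sp; rewrite starB star1 sp. Qed.

Lemma cone_sub_comm w b : w ** b = b ** w -> (cone - w) ** b = b ** (cone - w).
Proof. by move=> wb; rewrite cmulBl cmulBr cmul1l cmul1r wb. Qed.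

(** Stands in for the spectral bound 0 <= 1 - p^2 <= 1. Ford's lemma for p^2 gives z = 1 - w with
    z^2 + p^2 = 1; then |z| <= 1 by [sum_sq_bound], and |1 - p^2| = |z|^2. *)
Lemma nrm_cone_sub_sq p : star p = p -> nrm p <= 1 -> nrm (cone - p ** p) <= 1.
Proof.
move=> sp p1.
have [|w [sw _ ww wc]] := ford_sqrt (star_sq sp).
  by rewrite nrm_sa_sq // expr_le1 // nrm_ge0.
have zp : (cone - w) ** p = p ** (cone - w).
  by apply: cone_sub_comm; rewrite wc // cmulA.
have z1 : nrm (cone - w) <= 1.
  apply: (sum_sq_bound (q := p)) => //; first exact: sub_cone_sa.
  by rewrite ww subrK expr1n scale1r.
by rewrite -ww nrm_sa_sq ?expr_le1 ?nrm_ge0 //; apply: sub_cone_sa.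
Qed.

End Ford.

Section Positivity.
Variables (R : realType) (A : cstarAlgType R).
Implicit Types (a b h k p q w : A) (r s : R).

Lemma scale_realM r s a : r%:C%C *: (s%:C%C *: a) = (r * s)%:C%C *: a.
Proof. by rewrite scalerA -rmorphM. Qed.

Lemma scale_real1 a : (1 : R)%:C%C *: a = a.
Proof. by rewrite rmorph1 scale1r. Qed.

Lemma scale_sq r a : (r%:C%C *: a) ** (r%:C%C *: a) = (r ^+ 2)%:C%C *: (a ** a).
Proof. by rewrite cmulZl cmulZr scale_realM. Qed.

Lemma scale_comm r a b : a ** b = b ** a ->
  (r%:C%C *: a) ** b = b ** (r%:C%C *: a).
Proof. by move=> ab; rewrite cmulZl cmulZr ab. Qed.

Lemma scale_sa r a : star a = a -> star (r%:C%C *: a) = r%:C%C *: a.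
Proof. by move=> sa; rewrite starZr sa. Qed.

(* A selfadjoint square has a square root which is itself a selfadjoint square,
   in the bicommutant. *)
Lemma abs_sqrt p : star p = p -> exists g, [/\ star g = g,
  (g ** g) ** (g ** g) = p ** p &
  forall b, (p ** p) ** b = b ** (p ** p) -> g ** b = b ** g].
Proof.
move=> sp; pose s := nrm p + 1.
have s0 : 0 < s by have := nrm_ge0 p; rewrite /s; lra.
pose p1 := (s^-1)%:C%C *: p.
have sp1 : star p1 = p1 by exact: scale_sa.
have p11 : nrm p1 <= 1.
  rewrite nrmZr ger0_norm ?invr_ge0 ?(ltW s0) // mulrC ler_pdivrMr //.
  by rewrite mul1r /s; lra.
(* This gives (1 - w)^2 = p1^2. A second application, to [w] itself, gives (1 - w')^2 = 1 - w, so
   that the fourth power of 1 - w' is p1^2; the factor sqrt s undoes the scaling. *)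
have [w [sw w1 ww wc]] := ford_sqrt (sub_cone_sa (star_sq sp1)) (nrm_cone_sub_sq sp1 p11).
rewrite subKr in ww.
have [w' [sw' _ ww' wc']] := ford_sqrt sw w1.
pose t := Num.sqrt s.
have tt : t ^+ 2 = s by rewrite sqr_sqrtr ?ltW.
exists (t%:C%C *: (cone - w')); split.
- by apply/scale_sa/sub_cone_sa.
- rewrite !scale_sq ww' ww scale_sq scale_realM tt exprVn mulfV ?scale_real1 //.
  by rewrite expf_neq0 // gt_eqF.
- move=> b pb; apply/scale_comm/cone_sub_comm/wc'/wc/cone_sub_comm.
  by rewrite scale_sq; apply: scale_comm.
Qed.

(** After scaling, 1 - p1^2 and 1 - q1^2 have norm at most 1, hence so has their mean [h]. Ford's
    root of 1 - h is then a root of half of p1^2 + q1^2. *)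
Lemma sum_sq p q : star p = p -> star q = q ->
  exists2 r, star r = r & p ** p + q ** q = r ** r.
Proof.
move=> sp sq; pose s := nrm p + nrm q + 1.
have s0 : 0 < s by have := nrm_ge0 p; have := nrm_ge0 q; rewrite /s; lra.
have ns a : nrm a <= s -> nrm ((s^-1)%:C%C *: a) <= 1.
  move=> a_s; rewrite nrmZr ger0_norm ?invr_ge0 ?(ltW s0) // mulrC.
  by rewrite ler_pdivrMr // mul1r.
pose p1 := (s^-1)%:C%C *: p; pose q1 := (s^-1)%:C%C *: q.
have sp1 : star p1 = p1 by exact: scale_sa.
have sq1 : star q1 = q1 by exact: scale_sa.
have np1 : nrm p1 <= 1 by apply: ns; have := nrm_ge0 q; rewrite /s; lra.
have nq1 : nrm q1 <= 1 by apply: ns; have := nrm_ge0 p; rewrite /s; lra.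
pose h := (2^-1 : R)%:C%C *: ((cone - p1 ** p1) + (cone - q1 ** q1)).
have sh : star h = h.
  by apply: scale_sa; rewrite starD !sub_cone_sa ?star_sq.
have h1 : nrm h <= 1.
  rewrite nrmZr ger0_norm ?invr_ge0 //.
  have := nrmD (cone - p1 ** p1) (cone - q1 ** q1).
  by have := nrm_cone_sub_sq sp1 np1; have := nrm_cone_sub_sq sq1 nq1; lra.
have [w [sw _ ww _]] := ford_sqrt sh h1.
pose t := Num.sqrt (2 * s ^+ 2).
have tt : t ^+ 2 = 2 * s ^+ 2 by rewrite sqr_sqrtr // mulr_ge0 ?sqr_ge0.
exists (t%:C%C *: (cone - w)); first by apply/scale_sa/sub_cone_sa.
have hE : h = cone - (2^-1 : R)%:C%C *: (p1 ** p1 + q1 ** q1).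
  by rewrite /h addrACA -opprD scalerBr -half_split.
rewrite scale_sq ww tt hE subKr scale_realM !scale_sq -scalerDr scale_realM.
by rewrite -[LHS]scale_real1; congr (_%:C%C *: _); field; rewrite gt_eqF.
Qed.

Lemma neumann k : nrm k < 1 -> exists s : A, [/\ (cone - k) ** s = cone,
  s ** (cone - k) = cone & forall b, k ** b = b ** k -> s ** b = b ** s].
Proof.
move=> k1; set q := nrm k; have q0 : 0 <= q by exact: nrm_ge0.
pose u := fix u n := if n is m.+1 then cone + k ** u m else 0.
have uS n : u n.+1 = cone + k ** u n by [].
have du n : nrm (u n.+1 - u n) <= q ^+ n.
  elim: n => [|n IHn]; first by rewrite uS cmul0r addr0 subr0 expr0 nrm_cone.
  rewrite uS [in X in _ - X]uS opprD addrACA subrr add0r -cmulBr exprS.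
  by apply: (le_trans (nrmM _ _)); rewrite ler_wpM2l.
pose r n := (1 - q ^+ n) / (1 - q).
have rM n : r n <= (1 - q)^-1.
  by rewrite ler_pdivrMr ?mulVf ?subr_eq0 ?gt_eqF //; have := exprn_ge0 n q0; lra.
have dr n : r n.+1 - r n = q ^+ n.
  by rewrite /r exprS; field; rewrite subr_eq0 gt_eqF.
have [|s us] := majorant_limit (u := u) rM.
  by move=> n; rewrite dr.
have sc b : k ** b = b ** k -> s ** b = b ** s.
  move=> kb; apply/eqP; rewrite -subr_eq0; apply/eqP.
  apply: (limit_eq (f := fun x => x ** b - b ** x) (K := 2 * nrm b) us).
    elim=> [|n IHn]; first by rewrite cmul0l cmul0r subrr.
    move/eqP: IHn; rewrite subr_eq0 => /eqP IHn.
    rewrite uS cmulDl cmulDr cmul1l cmul1r -cmulA IHn cmulA kb cmulA subrr.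
    by [].
  move=> x _; rewrite subBB -cmulBl -cmulBr.
  apply: (le_trans (nrmB _ _)); rewrite (nrmC x).
  by have := nrmM (s - x) b; have := nrmM b (s - x); lra.
have ks : (cone - k) ** s = cone.
  rewrite cmulBl cmul1l; apply/eqP; rewrite -subr_eq0; apply/eqP.
  apply: nrm_le_eq0 => e e0.
  have [N uN] := us (e / 2) ltac:(lra).
  have -> : s - k ** s - cone = (s - u N.+1) + k ** (u N - s).
    by rewrite uS cmulBr addrA opprD addrA subrK addrAC.
  apply: (le_trans (nrmD _ _)); rewrite nrmC.
  have := uN _ (leqnSn N); have := uN _ (leqnn N).
  by have := nrmM k (u N - s); have := nrm_ge0 (u N - s); rewrite -/q; nra.
exists s; split => //.
by rewrite -[RHS]ks sc // cmulBl cmulBr cmul1l cmul1r.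
Qed.

Lemma inverse_unique a b b' : a ** b = cone -> b' ** a = cone -> b = b' :> A.
Proof. by move=> ab ba; rewrite -[b]cmul1l -ba -cmulA ab cmul1r. Qed.

Lemma inverse_comm a b d : a ** b = cone -> b ** a = cone ->
  a ** d = d ** a -> b ** d = d ** b.
Proof.
move=> ab ba ad.
by rewrite -[b ** d]cmul1r -ab cmulA -(cmulA b d) -ad !cmulA ba cmul1l.
Qed.

(** Replaces the fact that |z|^2 belongs to the spectrum of z^2. With M^2 = 1 - z^2, N^2 = 1 - Q / L
    and commuting factors, z^2 + (M N)^2 = 1 - 1 / L, so [sum_sq_bound] leaves a gap below 1. *)
Lemma lt1_of_inverse z (Q : A) : star z = z -> nrm z <= 1 ->
  (cone - z ** z) ** Q = cone -> Q ** (cone - z ** z) = cone -> nrm z < 1.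
Proof.
move=> sz z1 zQ Qz.
have sQ : star Q = Q.
  apply: (inverse_unique (a := cone - z ** z)) => //.
  by rewrite -[cone - _]sub_cone_sa ?star_sq // -starM Qz star1.
pose L := nrm Q + 1.
have L1 : 1 <= L by have := nrm_ge0 Q; rewrite /L; lra.
have L0 : 0 < L by lra.
have [m [sm _ mm mc]] := ford_sqrt (star_sq sz)
  (ltac:(by rewrite nrm_sa_sq // expr_le1 // nrm_ge0) : nrm (z ** z) <= 1).
have [||n [sn _ nn nc]] := @ford_sqrt _ _ ((L^-1)%:C%C *: Q).
- exact: scale_sa.
- rewrite nrmZr ger0_norm ?invr_ge0 ?(ltW L0) // mulrC ler_pdivrMr // mul1r.
  by rewrite /L; lra.
set M := cone - m in mm; set N := cone - n in nn.
(* [m] and [n] lie in the bicommutants of z^2 and of Q / L, and Q, as the inverse of 1 - z^2,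
   commutes with all that commutes with z^2. *)
have MN : M ** N = N ** M.
  rewrite /M; apply: cone_sub_comm; symmetry; apply: cone_sub_comm.
  apply/nc/scale_comm; apply: (inverse_comm zQ Qz); apply: cone_sub_comm.
  by symmetry; apply: mc.
have NZ : N ** z = z ** N.
  apply/cone_sub_comm/nc/scale_comm/(inverse_comm zQ Qz)/cone_sub_comm.
  by rewrite cmulA.
have MZ : M ** z = z ** M by apply/cone_sub_comm/mc; rewrite cmulA.
have e0 : 0 <= 1 - L^-1 by rewrite subr_ge0 invf_le1.
have e1 : 0 < L^-1 by rewrite invr_gt0.
apply: (@le_lt_trans _ _ (Num.sqrt (1 - L^-1))); last first.
  by rewrite -[ltRHS]sqrtr1 ltr_sqrt //; lra.
apply: (sum_sq_bound (q := M ** N)) => //.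
- by rewrite starM MN !sub_cone_sa.
- by rewrite cmulA -MZ -!cmulA NZ.
- rewrite sqr_sqrtr // -!cmulA (cmulA N M) -MN -(cmulA M N) nn !cmulA mm.
  rewrite cmulBr cmul1r cmulZr zQ addrA [z ** z + _]addrC subrK.
  by rewrite rmorphB scalerBl scale_real1.
Qed.

(* If [d^* d = - e^2] and [d d^* = k^2], then [1 - e^2 = 1 + d^* d] inherits an
   inverse from [1 + d d^*], which is incompatible with [|e| = 1]. *)
Lemma cstar_neg_eq0 d e k : star e = e -> star k = k ->
  star d ** d = - (e ** e) -> d ** star d = k ** k -> d = 0.
Proof.
move=> se sk de dk; apply: nrm_eq0; apply/eqP; apply: contraT => d0.
have dgt0 : 0 < nrm d by rewrite lt_def d0 nrm_ge0.
pose s := (nrm d)^-1; have s0 : `|s| = s by rewrite ger0_norm // invr_ge0 ltW.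
pose e1 := s%:C%C *: e; pose k1 := s%:C%C *: k; pose d1 := s%:C%C *: d.
have nd1 : nrm d1 = 1 by rewrite nrmZr s0 mulVf.
have de1 : star d1 ** d1 = - (e1 ** e1).
  by rewrite starZr cmulZl cmulZr scale_realM de scale_sq expr2 scalerN.
have dk1 : d1 ** star d1 = k1 ** k1.
  by rewrite starZr cmulZl cmulZr scale_realM dk scale_sq expr2.
have se1 : star e1 = e1 by exact: scale_sa.
have sk1 : star k1 = k1 by exact: scale_sa.
have ne1 : nrm e1 = 1.
  apply/eqP; rewrite -(@eqrXn2 _ 2) ?nrm_ge0 // -nrm_sa_sq //.
  by rewrite -nrmN -de1 nrm_cstar nd1.
have nk1 : nrm k1 = 1.
  apply/eqP; rewrite -(@eqrXn2 _ 2) ?nrm_ge0 // -nrm_sa_sq //.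
  by rewrite -dk1 -{1}[d1]starK nrm_cstar nrm_star nd1.
(* |h| <= 1/2, so the Neumann series inverts 1 - h, which is half of 1 + k1^2. *)
pose h := (2^-1 : R)%:C%C *: (cone - k1 ** k1).
have [|r [hr rh _]] := @neumann h.
  rewrite nrmZr ger0_norm ?invr_ge0 //.
  by have := @nrm_cone_sub_sq _ _ k1 sk1 ltac:(by rewrite nk1); lra.
have hE : cone - h = (2^-1 : R)%:C%C *: (cone + k1 ** k1).
  by rewrite /h {1}(half_split cone) -scalerBr opprB addrACA subrr addr0.
pose r2 := (2^-1 : R)%:C%C *: r.
have kr : (cone + d1 ** star d1) ** r2 = cone by rewrite dk1 cmulZr -cmulZl -hE.
have rk : r2 ** (cone + d1 ** star d1) = cone by rewrite dk1 cmulZl -cmulZr -hE.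
(* The usual transfer of inverses: if [r2] inverts 1 + x y, then 1 - y r2 x inverts 1 + y x. *)
pose Q := cone - star d1 ** r2 ** d1.
have eE : cone - e1 ** e1 = cone + star d1 ** d1 by rewrite de1.
suff : nrm e1 < 1 by rewrite ne1 ltxx.
apply: (lt1_of_inverse (Q := Q)); rewrite ?ne1 // eE /Q.
- rewrite cmulBr cmul1r cmulDl cmul1l.
  have -> : star d1 ** d1 ** (star d1 ** r2 ** d1) =
            star d1 ** (d1 ** star d1 ** r2) ** d1 by rewrite !cmulA.
  rewrite -cmulDl -cmulDr.
  have -> : r2 + d1 ** star d1 ** r2 = cone by rewrite -kr cmulDl cmul1l.
  by rewrite cmul1r addrK.
- rewrite cmulBl cmul1l cmulDr cmul1r.
  have -> : star d1 ** r2 ** d1 ** (star d1 ** d1) =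
            star d1 ** (r2 ** (d1 ** star d1)) ** d1 by rewrite !cmulA.
  rewrite -cmulDl -cmulDr.
  have -> : r2 + r2 ** (d1 ** star d1) = cone by rewrite -rk cmulDr cmul1r.
  by rewrite cmul1r addrK.
Qed.

(** [a] and [b] are, up to sign, sqrt 2 times the real and imaginary parts of [d]; the terms d^2 and
    its adjoint cancel in the sum of their squares. *)
Lemma cartesian_sum d : exists a b, [/\ star a = a, star b = b &
  star d ** d + d ** star d = a ** a + b ** b].
Proof.
pose t := Num.sqrt (2^-1 : R).
have tt : t ^+ 2 = 2^-1 by rewrite sqr_sqrtr.
exists (t%:C%C *: (d + star d)), (t%:C%C *: ('i *: (d - star d))); split.
- by apply: scale_sa; rewrite starD starK addrC.
- by apply: scale_sa; rewrite starZ starB starK conjCi scaleNr -scalerN opprB.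
- rewrite !scale_sq tt cmulZl cmulZr scalerA -expr2 sqrCi scaleN1r -scalerDr.
  set x := star d ** d; set y := d ** star d; set z := d ** d + star d ** star d.
  have -> : (d + star d) ** (d + star d) = z + (x + y).
    by rewrite cmulDl !cmulDr (addrC (star d ** d)) addrACA (addrC (d ** star d)).
  have -> : (d - star d) ** (d - star d) = z - (x + y).
    by rewrite cmulBl !cmulBr opprB addrACA -opprD (addrC (d ** star d)).
  by rewrite opprB [X in _ *: X]addrC addrA subrK -half_split.
Qed.

(** Put h = c^* c, k = |h| and let m = k - h be twice the negative part of [h]. For d = c m one
    finds d^* d = m h m = - (g m)^2, so that d d^* is a sum of squares of selfadjoint elements by
    [cartesian_sum], and [cstar_neg_eq0] yields d = 0. Hence m h m and m k m vanish, so m^3 = 0, m =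
    0 and h = k = g^2. *)
Lemma cstar_sqrt (c : A) : exists2 r, star r = r & star c ** c = r ** r.
Proof.
have [h hE] : exists h, star c ** c = h by exists (star c ** c).
have sh : star h = h by rewrite -hE star_cstar.
have [g [sg gg gc]] := abs_sqrt sh.
have gh : g ** h = h ** g by apply: gc; rewrite cmulA.
have [k kE] : exists k, g ** g = k by exists (g ** g).
have sk : star k = k by rewrite -kE star_sq.
have kh : k ** h = h ** k by rewrite -kE -cmulA gh cmulA gh -cmulA.
have gk : g ** k = k ** g by rewrite -kE cmulA.
have [m mE] : exists m, k - h = m by exists (k - h).
have sm : star m = m by rewrite -mE starB sk sh.
have gm : g ** m = m ** g by rewrite -mE cmulBr cmulBl gh gk.
have mh : m ** h = - (m ** k).
  by rewrite -mE !cmulBl -gg kE kh opprB.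
have [d dE] : exists d, c ** m = d by exists (c ** m).
have [e eE] : exists e, g ** m = e by exists (g ** m).
have se : star e = e by rewrite -eE starM sm sg.
have de : star d ** d = - (e ** e).
  rewrite -dE starM sm -cmulA (cmulA (star c)) hE cmulA mh cmulNl.
  by rewrite -eE -kE gm -!cmulA gm.
have [a [b [sa sb ab]]] := cartesian_sum d.
have [r1 sr1 abr] := sum_sq sa sb.
have [k1 sk1 rek] := sum_sq sr1 se.
have dk : d ** star d = k1 ** k1.
  by rewrite -rek -abr -ab de addrAC addNr add0r.
have d0 := cstar_neg_eq0 se sk1 de dk.
have mmh : m ** h ** m = 0.
  by rewrite -hE -cmulA -[_ ** c ** m]cmulA dE d0 !cmul0r.
have m3 : m ** m ** m = 0.
  have mmk : m ** k ** m = 0 by apply/eqP; rewrite -oppr_eq0 -cmulNl -mh mmh.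
  by rewrite -{2}mE cmulBr cmulBl mmk mmh subrr.
have m0 : m = 0.
  have := nrm_sa_sq (star_sq sm); rewrite cmulA m3 cmul0l nrm0 nrm_sa_sq //.
  by move=> /esym/eqP; rewrite !expf_eq0 /= => /eqP/nrm_eq0.
by exists g => //; rewrite hE kE; apply/eqP; rewrite eq_sym -subr_eq0 mE m0.
Qed.

Lemma positive_eltP (a : A) :
  positive_elt a <-> exists2 r, star r = r & a = r ** r.
Proof.
split=> [[c ->]|[r sr ->]]; first exact: cstar_sqrt.
by exists r; rewrite sr.
Qed.

Lemma positive_elt0 : positive_elt (0 : A).
Proof. by exists 0; rewrite cmul0r. Qed.

Lemma positive_eltD a b : positive_elt a -> positive_elt b -> positive_elt (a + b).
Proof.
move=> /positive_eltP[r sr ->] /positive_eltP[s ss ->].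
by apply/positive_eltP; have [t st ->] := sum_sq sr ss; exists t.
Qed.

Lemma positive_elt_sum (I : Type) (s : seq I) (f : I -> A) :
  (forall i, positive_elt (f i)) -> positive_elt (\sum_(i <- s) f i).
Proof.
move=> pf; elim/big_rec: _ => [|i x _ px]; first exact: positive_elt0.
exact: positive_eltD.
Qed.

(** Write 1 + a = g^2. The inverse [x] of g^2 commutes with [g], so g x is selfadjoint and is the
    inverse of [g]. *)
Lemma inverse_sqrt_positive a : positive_elt a ->
  exists2 s, star s = s & s ** (cone + a) ** s = cone.
Proof.
move=> /positive_eltP[r sr ->].
have [g sg gg] := sum_sq (star1 A) sr; rewrite cmul1l in gg.
pose rho := nrm r + 1; pose t := 1 + rho ^+ 2.
have rho0 : 0 < rho by have := nrm_ge0 r; rewrite /rho; lra.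
have t0 : 0 < t by have := sqr_ge0 rho; rewrite /t; lra.
pose p := (rho^-1)%:C%C *: r.
have sp : star p = p by exact: scale_sa.
have p1 : nrm p <= 1.
  rewrite nrmZr ger0_norm ?invr_ge0 ?(ltW rho0) // mulrC ler_pdivrMr //.
  by rewrite mul1r /rho; lra.
(* Chosen so that 1 - k = (1 + r^2) / t, while the factor rho^2 / t < 1 keeps |k| below 1. *)
pose k := (rho ^+ 2 / t)%:C%C *: (cone - p ** p).
have kt : 0 <= rho ^+ 2 / t < 1.
  rewrite divr_ge0 ?sqr_ge0 ?(ltW t0) //= ltr_pdivrMr // mul1r /t.
  by lra.
have k1 : nrm k < 1.
  rewrite nrmZr ger0_norm; last by case/andP: kt.
  by have := nrm_cone_sub_sq sp p1; have := nrm_ge0 (cone - p ** p); nra.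
have [q [kq qk _]] := neumann k1.
have kE : cone - k = (t^-1)%:C%C *: (cone + r ** r).
  rewrite /k scalerBr scale_sq scale_realM opprB addrC -addrA addrC.
  have -> : rho ^+ 2 / t * rho^-1 ^+ 2 = t^-1.
    by field; rewrite !gt_eqF.
  have -> : - ((rho ^+ 2 / t)%:C%C *: cone) + cone = (t^-1)%:C%C *: cone :> A.
    rewrite -[X in _ + X]scale_real1 -scaleNr -rmorphN -scalerDl -rmorphD /=.
    by congr (_%:C%C *: _); rewrite /t; field; rewrite gt_eqF.
  by rewrite -scalerDr.
pose x := (t^-1)%:C%C *: q.
have Xx : g ** g ** x = cone by rewrite -gg cmulZr -cmulZl -kE.
have xX : x ** (g ** g) = cone by rewrite -gg cmulZl -cmulZr -kE.
have xg : x ** g = g ** x by apply: (inverse_comm Xx xX); rewrite cmulA.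
have sx : star x = x.
  by apply: (inverse_unique (a := g ** g)) => //; rewrite -{1}(star_sq sg) -starM xX star1.
exists (g ** x); first by rewrite starM sx sg.
by rewrite gg -(cmulA g x) xX cmul1r cmulA.
Qed.

End Positivity.

(** * Hilbert modules and Hilbert spaces *)

Section ModuleTheory.
Variables (R : realType) (A : cstarAlgType R).
Implicit Types (E F : preHilbertModType A) (a b : A) (c : complex R).

Lemma ipDr E (x y z : E) : ip x (y + z) = ip x y + ip x z.
Proof. by have := ip_linear x 1 y z; rewrite !scale1r. Qed.

Lemma ip0r E (x : E) : ip x 0 = 0.
Proof. by apply: (addrI (ip x 0)); rewrite -ipDr !addr0. Qed.

Lemma ipZr E (x : E) c (y : E) : ip x (c *: y) = c *: ip x y.
Proof. by rewrite -[c *: y]addr0 ip_linear ip0r addr0. Qed.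

Lemma ipNr E (x y : E) : ip x (- y) = - ip x y.
Proof. by rewrite -scaleN1r ipZr scaleN1r. Qed.

Lemma ipBr E (x y z : E) : ip x (y - z) = ip x y - ip x z.
Proof. by rewrite ipDr ipNr. Qed.

Lemma ipDl E (x y z : E) : ip (x + y) z = ip x z + ip y z.
Proof. by rewrite -ip_star ipDr starD !ip_star. Qed.

Lemma ipBl E (x y z : E) : ip (x - y) z = ip x z - ip y z.
Proof. by rewrite -ip_star ipBr starB !ip_star. Qed.

Lemma ip_ractl E (x y : E) a : ip (ract x a) y = star a ** ip x y.
Proof. by rewrite -ip_star ip_ract starM ip_star. Qed.

Lemma nrm_ip E (x : E) : nrm (ip x x) = nrm x ^+ 2.
Proof. by apply: complexI; rewrite rmorphXn /= -!nrmE ip_norm. Qed.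

Lemma ip_eq0 E (x : E) : ip x x = 0 -> x = 0.
Proof.
move=> xx; have := ip_norm x; rewrite xx normr0 => /esym/eqP.
by rewrite expf_eq0 /= normr_eq0 => /eqP.
Qed.

Lemma ip_ext E (x y : E) : (forall z, ip z x = ip z y) -> x = y.
Proof.
by move=> xy; apply/eqP; rewrite -subr_eq0; apply/eqP/ip_eq0; rewrite ipBr xy subrr.
Qed.

Lemma adjPl E F (f : adjointable E F) x y : ip x (f y) = ip (adj f x) y.
Proof. by rewrite -ip_star adjP ip_star. Qed.

Lemma adjointable_linear E F (f : adjointable E F) : linear f.
Proof.
by move=> c x y; apply: ip_ext => z; rewrite adjPl ip_linear -!adjPl ip_linear.
Qed.

Lemma adjointable_ract E F (f : adjointable E F) x a : f (ract x a) = ract (f x) a.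
Proof. by apply: ip_ext => z; rewrite !(adjPl, ip_ract). Qed.

(* If [sum <x_i, y_i> = 1] then [f_i = x_i + y_i] satisfies
   [sum <f_i, f_i> = 2 + a] with [a] positive, and can be normalized. *)
Lemma full_frame E : full E ->
  exists n (z : 'I_n -> E), \sum_(i < n) ip (z i) (z i) = cone.
Proof.
move=> fullE.
have /closure_nrmP/(_ 1 ltr01)[_ [n [c [s [s_ip ->]]]] s1] :
    closure (linear_span [set a | exists x y : E, a = ip x y]) (cone : A).
  by rewrite fullE.
(* An element of the span at distance less than 1 from the unit is invertible; its inverse [q] is
   absorbed into the vectors [y']. *)
have [q [sq _ _]] := neumann s1; rewrite subKr in sq.
have [x /choice[y xy]] := choice s_ip.
pose y' i := c i *: ract (y i) q.
have xy1 : \sum_(i < n) ip (x i) (y' i) = cone.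
  rewrite -sq cmul_suml; apply: eq_bigr => i _.
  by rewrite xy ipZr ip_ract cmulZl.
pose f i := x i + y' i.
pose a := cone + \sum_(i < n) (ip (x i) (x i) + ip (y' i) (y' i)).
have pa : positive_elt a.
  apply: positive_eltD; first by exists cone; rewrite star1 cmul1l.
  by apply: positive_elt_sum => i; apply: positive_eltD; exact: ip_pos.
have ff : \sum_(i < n) ip (f i) (f i) = cone + a.
  have -> : cone + a = \sum_(i < n) ip (x i) (y' i) + (\sum_(i < n) ip (y' i) (x i) +
      \sum_(i < n) (ip (x i) (x i) + ip (y' i) (y' i))).
    rewrite xy1 /a; congr (_ + (_ + _)).
    by rewrite -star1 -xy1 star_sum; apply: eq_bigr => i _; rewrite ip_star.
  rewrite -!big_split; apply: eq_bigr => i _ /=; rewrite ipDl !ipDr.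
  by rewrite [ip (x i) (x i) + _]addrC -addrA [in LHS](addrCA (ip (x i) (x i))).
have [t st tat] := inverse_sqrt_positive pa.
exists n, (fun i => ract (f i) t).
rewrite -[RHS]tat -ff cmul_sumr cmul_suml; apply: eq_bigr => i _.
by rewrite ip_ract ip_ractl st.
Qed.

End ModuleTheory.

Section HilbertTheory.
Variables (R : realType).
Implicit Types (H K : hilbertType R) (c : complex R).

Definition cabs c : R := complex.Re `|c|.

Lemma cabsE c : `|c| = (cabs c)%:C%C.
Proof. exact: ge0_complexRe. Qed.

Lemma cabs_ge0 c : 0 <= cabs c.
Proof. by rewrite -ler0c -cabsE. Qed.

Lemma cabs_eq0 c : cabs c = 0 -> c = 0.
Proof. by move=> h; apply/eqP; rewrite -normr_eq0 cabsE h. Qed.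

Lemma cabs_small c : (forall e : R, 0 < e -> cabs c <= e) -> c = 0.
Proof.
move=> h; apply: cabs_eq0; apply/eqP; rewrite eq_le cabs_ge0 andbT.
by apply/ler_addgt0Pr => e e0; rewrite add0r h.
Qed.

Lemma hdotDr H (x y z : H) : hdot x (y + z) = hdot x y + hdot x z.
Proof. by have := hdot_linear x 1 y z; rewrite !scale1r mul1r. Qed.

Lemma hdot0r H (x : H) : hdot x 0 = 0.
Proof. by apply: (addrI (hdot x 0)); rewrite -hdotDr !addr0. Qed.

Lemma hdotZr H (x : H) c (y : H) : hdot x (c *: y) = c * hdot x y.
Proof. by rewrite -[c *: y]addr0 hdot_linear hdot0r addr0. Qed.

Lemma hdotBr H (x y z : H) : hdot x (y - z) = hdot x y - hdot x z.
Proof. by rewrite hdotDr -scaleN1r hdotZr mulN1r. Qed.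

Lemma hdot_sumr H (x : H) (I : Type) (s : seq I) (f : I -> H) :
  hdot x (\sum_(i <- s) f i) = \sum_(i <- s) hdot x (f i).
Proof. by elim/big_rec2: _ => [|i y z _ <-]; rewrite ?hdot0r ?hdotDr. Qed.

Lemma hdotDl H (x y z : H) : hdot (x + y) z = hdot x z + hdot y z.
Proof. by rewrite hdotC hdotDr rmorphD /= -!hdotC. Qed.

Lemma hdot0l H (x : H) : hdot 0 x = 0.
Proof. by rewrite hdotC hdot0r conjC0. Qed.

Lemma hdotZl H c (x y : H) : hdot (c *: x) y = c^* * hdot x y.
Proof. by rewrite hdotC hdotZr rmorphM /= -hdotC. Qed.

Lemma hdot_suml H (x : H) (I : Type) (s : seq I) (f : I -> H) :
  hdot (\sum_(i <- s) f i) x = \sum_(i <- s) hdot (f i) x.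
Proof. by elim/big_rec2: _ => [|i y z _ <-]; rewrite ?hdot0l ?hdotDl. Qed.

Lemma hdot_nrm H (x : H) : hdot x x = (nrm x ^+ 2)%:C%C.
Proof. by rewrite hdot_norm nrmE rmorphXn. Qed.

Lemma hdot_eq0 H (x : H) : hdot x x = 0 -> x = 0.
Proof.
rewrite hdot_nrm => /complexI/eqP; rewrite expf_eq0 /= => /eqP.
exact: nrm_eq0.
Qed.

Lemma hdot_ext H (x y : H) : (forall z, hdot z x = hdot z y) -> x = y.
Proof.
by move=> xy; apply/eqP; rewrite -subr_eq0; apply/eqP/hdot_eq0; rewrite hdotBr xy subrr.
Qed.


End HilbertTheory.

(** * Cauchy-Schwarz and triangle inequalities for positive definite forms *)

Section HermitianForm.
Variables (R : realType) (U : lmodType (complex R)).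
Variables (form : U -> U -> complex R) (q : U -> R).
Hypothesis formC : forall x y, form y x = (form x y)^*.
Hypothesis form_linear : forall x (c : complex R) y z,
  form x (c *: y + z) = c * form x y + form x z.
Hypothesis q_ge0 : forall x, 0 <= q x.
Hypothesis formq : forall x, form x x = (q x ^+ 2)%:C%C.
Hypothesis q_eq0 : forall x, q x = 0 -> x = 0.

Let formDr x y z : form x (y + z) = form x y + form x z.
Proof. by have := form_linear x 1 y z; rewrite !scale1r mul1r. Qed.

Let form0r x : form x 0 = 0.
Proof. by apply: (addrI (form x 0)); rewrite -formDr !addr0. Qed.

Let formZr x (c : complex R) y : form x (c *: y) = c * form x y.
Proof. by rewrite -[c *: y]addr0 form_linear form0r addr0. Qed.

Let formBr x y z : form x (y - z) = form x y - form x z.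
Proof. by rewrite formDr -scaleN1r formZr mulN1r. Qed.

Let formBl x y z : form (x - y) z = form x z - form y z.
Proof. by rewrite formC formBr rmorphB /= -!formC. Qed.

Let formDl x y z : form (x + y) z = form x z + form y z.
Proof. by rewrite formC formDr rmorphD /= -!formC. Qed.

Let formZl (c : complex R) x y : form (c *: x) y = c^* * form x y.
Proof. by rewrite formC formZr rmorphM /= -formC. Qed.

(** Stated for a bare form because it serves twice: for Hilbert spaces already given, and for
    [hspan], whose norm only becomes one through the triangle inequality derived from it. *)
Lemma form_cauchy_schwarz x y : cabs (form x y) <= q x * q y.
Proof.
have [y0|y0] := eqVneq (q y) 0.
  by rewrite y0 mulr0 (q_eq0 y0) form0r /cabs normr0.
have ny0 : 0 < q y by rewrite lt_def y0 q_ge0.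
set c := form x y; pose N : complex R := (q y ^+ 2)%:C%C.
have N0 : N != 0 by rewrite fmorph_eq0 expf_neq0.
pose t := c^* / N; pose z := x - t *: y.
have tE : t^* = c / N by rewrite /t rmorphM /= conjCK fmorphV /= /N conj_real.
have zz : form z z = (q x ^+ 2)%:C%C - `|c| ^+ 2 / N.
  rewrite formBl !formBr !formZl !formZr !formq -/c -/N (formC x y) -/c.
  rewrite tE /t normCK; move: N0; move: (N) (c^*) => N' c' N0'; field; exact: N0'.
have : 0 <= form z z by rewrite formq ler0c sqr_ge0.
rewrite zz subr_ge0 ler_pdivrMr; last by rewrite ltcR exprn_gt0.
rewrite cabsE -rmorphXn -rmorphM lecR -exprMn => h.
by rewrite -(@ler_pXn2r _ 2) // nnegrE ?cabs_ge0 // mulr_ge0 ?q_ge0.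
Qed.

Lemma form_triangle x y : q (x + y) <= q x + q y.
Proof.
rewrite -(@ler_pXn2r _ 2) ?nnegrE ?addr_ge0 ?q_ge0 // -lecR -formq.
rewrite formDl !formDr !formq (formC x y).
have -> : ((q x + q y) ^+ 2)%:C%C = (q x ^+ 2)%:C%C + (q y ^+ 2)%:C%C
    + (2 * (q x * q y))%:C%C :> complex R by rewrite -!rmorphD; congr (_%:C)%C; ring.
set c := form x y.
have -> : (q x ^+ 2)%:C%C + c + (c^* + (q y ^+ 2)%:C%C) =
   (q x ^+ 2)%:C%C + (q y ^+ 2)%:C%C + (c + c^*) by ring.
rewrite lerD2l; apply: le_trans (_ : `|c + c^*| <= _).
  apply: real_ler_norm; apply/CrealP; rewrite rmorphD /= conjCK; exact: addrC.
apply: (le_trans (ler_normD _ _)); rewrite norm_conjC cabsE -rmorphD lecR.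
by have := form_cauchy_schwarz x y; rewrite -/c; lra.
Qed.

Lemma form_homogeneous (c : complex R) x : q (c *: x) = cabs c * q x.
Proof.
apply/eqP; rewrite -(@eqrXn2 _ 2) ?mulr_ge0 ?cabs_ge0 ?q_ge0 //; apply/eqP.
apply: complexI; rewrite -formq formZl formZr formq mulrA -normCKC cabsE.
by rewrite -rmorphXn -rmorphM exprMn.
Qed.

End HermitianForm.

Section HilbertTheory.
Variables (R : realType).
Implicit Types (H K : hilbertType R) (c : complex R).

Lemma cauchy_schwarz H (x y : H) : cabs (hdot x y) <= nrm x * nrm y.
Proof.
apply: form_cauchy_schwarz; [exact: hdotC | exact: hdot_linear | exact: nrm_ge0 |
  exact: hdot_nrm | exact: nrm_eq0].
Qed.

Lemma bounded_linearP (U V : normedModType (complex R)) (f : U -> V) :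
  bounded_linear f <->
  linear f /\ exists2 M : R, 0 <= M & forall x, nrm (f x) <= M * nrm x.
Proof.
split=> -[lf [M]] => [fM|M0 fM]; split=> //.
  exists `|complex.Re M|; first exact: normr_ge0.
  move=> x; have := fM x; rewrite lecE /= => /andP[_].
  rewrite !nrmE /= => /le_trans; apply.
  case: (M) => a b /=; rewrite mulr0 subr0.
  by rewrite ler_wpM2r ?nrm_ge0 // ler_norm.
by exists M%:C%C => x; rewrite !nrmE -rmorphM lecR.
Qed.

Lemma linear0_fun (U V : lmodType (complex R)) (f : U -> V) : linear f -> f 0 = 0.
Proof.
by move=> lf; have := lf (-1) 0 0; rewrite scaler0 add0r scaleN1r addNr.
Qed.

Lemma linearD_fun (U V : lmodType (complex R)) (f : U -> V) x y :
  linear f -> f (x + y) = f x + f y.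
Proof. by move=> lf; have := lf 1 x y; rewrite !scale1r. Qed.

Lemma linearZ_fun (U V : lmodType (complex R)) (f : U -> V) c x :
  linear f -> f (c *: x) = c *: f x.
Proof. by move=> lf; have := lf c x 0; rewrite (linear0_fun lf) !addr0. Qed.

Lemma linearB_fun (U V : lmodType (complex R)) (f : U -> V) x y :
  linear f -> f (x - y) = f x - f y.
Proof.
by move=> lf; rewrite -scaleN1r linearD_fun // linearZ_fun // scaleN1r.
Qed.

Lemma linear_sum_fun (U V : lmodType (complex R)) (f : U -> V)
    (I : Type) (s : seq I) (g : I -> U) :
  linear f -> f (\sum_(i <- s) g i) = \sum_(i <- s) f (g i).
Proof.
move=> lf; elim/big_rec2: _ => [|i y z _ <-]; first exact: linear0_fun.
by rewrite linearD_fun.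
Qed.

Lemma bounded_linear_comp (U V W : normedModType (complex R)) (f : U -> V) (g : V -> W) :
  bounded_linear f -> bounded_linear g -> bounded_linear (g \o f).
Proof.
move=> /bounded_linearP[lf [M M0 fM]] /bounded_linearP[lg [N N0 gN]].
apply/bounded_linearP; split=> [c x y|]; first by rewrite /= lf lg.
exists (N * M); first exact: mulr_ge0.
move=> x /=; apply: (le_trans (gN _)).
by rewrite -mulrA ler_wpM2l.
Qed.

Lemma bounded_linear_comb (U V : normedModType (complex R)) c (f g : U -> V) :
  bounded_linear f -> bounded_linear g -> bounded_linear (fun x => c *: f x + g x).
Proof.
move=> /bounded_linearP[lf [M M0 fM]] /bounded_linearP[lg [N N0 gN]].
apply/bounded_linearP; split=> [d x y|].
  by rewrite lf lg !scalerDr !scalerA mulrC addrACA.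
exists (cabs c * M + N); first by rewrite addr_ge0 ?mulr_ge0 ?cabs_ge0.
move=> h; apply: (le_trans (nrmD _ _)); rewrite nrmZ -/(cabs c) mulrDl -mulrA.
by rewrite lerD // ler_wpM2l ?cabs_ge0.
Qed.

(** The two sides may live in different Hilbert spaces, so that adjoint and intertwining relations,
    and not only equalities of operators, can be checked on generators. *)
Lemma total_agree (K K1 K2 : hilbertType R) (S : set K) (P : K -> K1) (Q : K -> K2)
    (z : K1) (z' : K2) :
  closure (linear_span S) = [set: K] -> bounded_linear P -> bounded_linear Q ->
  (forall s, S s -> hdot z (P s) = hdot z' (Q s)) ->
  forall f, hdot z (P f) = hdot z' (Q f).
Proof.
move=> totS /bounded_linearP[lP [M M0 PM]] /bounded_linearP[lQ [N N0 QN]] PQ f.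
apply/eqP; rewrite -subr_eq0; apply/eqP; apply: cabs_small => e e0.
pose T := nrm z * M + nrm z' * N + 1.
have T0 : 0 < T by have := nrm_ge0 z; have := nrm_ge0 z'; rewrite /T; nra.
have clf : closure (linear_span S) f by rewrite totS.
have [g [n [c [s [Ss gE]]]] fg] := (closure_nrmP _ _).1 clf _ (divr_gt0 e0 T0).
have PQg : hdot z (P g) = hdot z' (Q g).
  rewrite gE (linear_sum_fun _ _ lP) (linear_sum_fun _ _ lQ) !hdot_sumr; apply: eq_bigr => i _.
  by rewrite (linearZ_fun _ _ lP) (linearZ_fun _ _ lQ) !hdotZr PQ.
have -> : hdot z (P f) - hdot z' (Q f) = hdot z (P (f - g)) - hdot z' (Q (f - g)).
  by rewrite (linearB_fun _ _ lP) (linearB_fun _ _ lQ) !hdotBr PQg subBB subrr subr0.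
rewrite -lecR -cabsE; apply: (le_trans (ler_normB _ _)); rewrite !cabsE -rmorphD lecR.
have := cauchy_schwarz z (P (f - g)); have := cauchy_schwarz z' (Q (f - g)).
have := PM (f - g); have := QN (f - g).
move: fg; rewrite ltr_pdivlMr // /T.
have := nrm_ge0 z; have := nrm_ge0 z'; have := nrm_ge0 (f - g).
set x := nrm (f - g) => x0 z0 z'0 xT h1 h2 h3 h4.
have : nrm z * nrm (P (f - g)) <= nrm z * (M * x) by rewrite ler_wpM2l.
have : nrm z' * nrm (Q (f - g)) <= nrm z' * (N * x) by rewrite ler_wpM2l.
by lra.
Qed.

Lemma bounded_linear_id (U : normedModType (complex R)) : bounded_linear (fun x : U => x).
Proof. by apply/bounded_linearP; split=> //; exists 1 => // x; rewrite mul1r. Qed.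

Lemma total_ext (K K1 : hilbertType R) (S : set K) (P Q : K -> K1) :
  closure (linear_span S) = [set: K] -> bounded_linear P -> bounded_linear Q ->
  (forall s, S s -> P s = Q s) -> P =1 Q.
Proof.
move=> totS bP bQ PQ f; apply: hdot_ext => z.
by apply: (total_agree totS bP bQ) => s Ss; rewrite PQ.
Qed.

Lemma total_vec (K : hilbertType R) (S : set K) (x y : K) :
  closure (linear_span S) = [set: K] ->
  (forall s, S s -> hdot s x = hdot s y) -> x = y.
Proof.
move=> totS xy; apply: hdot_ext => z; rewrite hdotC [RHS]hdotC; congr (_^*).
apply: (total_agree totS (@bounded_linear_id K) (@bounded_linear_id K)) => s Ss.
by rewrite hdotC xy // -hdotC.
Qed.

End HilbertTheory.

(** * Operators of a von Neumann algebra and interior tensor products *)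

Section VonNeumannAlgebraTheory.
Variables (R : realType) (H : hilbertType R) (B : vonNeumannAlgebra H).
Implicit Types (a b g : B) (h k : H).

Lemma vna_opD a b h : vna_op (a + b) h = vna_op a h + vna_op b h.
Proof. exact: (linearD_fun _ _ (vna_op_linear h)). Qed.

Lemma vna_opZ (c : complex R) b h : vna_op (c *: b) h = c *: vna_op b h.
Proof. exact: (linearZ_fun _ _ (vna_op_linear h)). Qed.

Lemma vna_opB a b h : vna_op (a - b) h = vna_op a h - vna_op b h.
Proof. exact: (linearB_fun _ _ (vna_op_linear h)). Qed.

Lemma vna_op_sum (I : Type) (s : seq I) (f : I -> B) h :
  vna_op (\sum_(i <- s) f i) h = \sum_(i <- s) vna_op (f i) h.
Proof. exact: (linear_sum_fun _ _ (vna_op_linear h)). Qed.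

Lemma vna_op_lin b : linear (vna_op b).
Proof. by case: (vna_op_bounded b). Qed.

Lemma vna_op_starr b h k : hdot h (vna_op (star b) k) = hdot (vna_op b h) k.
Proof. by rewrite -vna_op_star starK. Qed.

Lemma vna_op_sq b h : hdot h (vna_op (star b ** b) h) = (nrm (vna_op b h) ^+ 2)%:C%C.
Proof. by rewrite vna_opM vna_op_starr hdot_nrm. Qed.

Lemma vna_ext a b :
  (forall h k, hdot h (vna_op a k) = hdot h (vna_op b k)) -> a = b.
Proof.
move=> ab; apply: vna_op_inj; apply/funext => k.
by apply: hdot_ext => h.
Qed.

(** With [nrm_le_vna_op] this identifies the abstract norm of B with the operator norm. For |b1| =
    1, Ford's lemma writes 1 - b1^* b1 as the square of a selfadjoint element, whose quadratic form
    is nonnegative. *)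
Lemma nrm_vna_op b h : nrm (vna_op b h) <= nrm b * nrm h.
Proof.
have [/nrm_eq0 ->|b0] := eqVneq (nrm b) 0.
  by rewrite (linear0_fun (vna_op_linear h)) !nrm0 mul0r.
have nb0 : 0 < nrm b by rewrite lt_def b0 nrm_ge0.
pose r := (nrm b)^-1; pose b1 := r%:C%C *: b.
have r0 : 0 <= r by rewrite invr_ge0 nrm_ge0.
have b11 : nrm b1 = 1 by rewrite nrmZr ger0_norm // mulVf.
have [|w [sw _ ww _]] := ford_sqrt (star_cstar b1).
  by rewrite nrm_cstar b11 expr1n.
have : 0 <= hdot h (vna_op ((cone - w) ** (cone - w)) h).
  by rewrite -{1}(sub_cone_sa sw) vna_op_sq ler0c sqr_ge0.
rewrite ww vna_opB vna_op1 hdotBr vna_op_sq hdot_nrm -rmorphB ler0c subr_ge0.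
rewrite ler_pXn2r ?nnegrE ?nrm_ge0 // vna_opZ nrmZr ger0_norm //.
by rewrite mulrC ler_pdivrMr // mulrC.
Qed.

Lemma nrm_vna_op_star b (M : R) : 0 <= M ->
  (forall h, nrm (vna_op b h) <= M * nrm h) ->
  forall h, nrm (vna_op (star b) h) <= M * nrm h.
Proof.
move=> M0 bM h; set x := vna_op (star b) h.
have := cauchy_schwarz h (vna_op b x).
have -> : hdot h (vna_op b x) = (nrm x ^+ 2)%:C%C.
  by rewrite -vna_op_star -/x hdot_nrm.
have -> : cabs (nrm x ^+ 2)%:C%C = nrm x ^+ 2.
  by rewrite /cabs ger0_norm // ler0c sqr_ge0.
have := bM x; have := nrm_ge0 x; have := nrm_ge0 h.
set s := nrm x; set t := nrm h => t0 s0 h1 h2.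
have : s ^+ 2 <= t * (M * s) by apply: (le_trans h2); rewrite ler_wpM2l.
have Mt : 0 <= M * t by exact: mulr_ge0.
rewrite le_eqVlt in s0; case/predU1P: s0 => [<- _ //|s0].
by rewrite mulrA mulrC expr2 ler_pM2l // mulrC.
Qed.

(* The selfadjoint square [g^2 = |b|] is also positive as an operator, and a
   positive operator has at most one positive square root commuting with it. *)
Lemma vna_positive_sqrt b : star b = b ->
  (forall h, 0 <= hdot h (vna_op b h)) -> exists g, [/\ star g = g, b = g ** g &
    forall a, b ** a = a ** b -> g ** a = a ** g].
Proof.
move=> sb b0; have [g [sg gg gc]] := abs_sqrt sb.
have gb a : b ** a = a ** b -> g ** a = a ** g.
  by move=> ba; apply: gc; rewrite -cmulA ba cmulA ba -cmulA.
have gbb : g ** b = b ** g by exact: gb.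
exists g; split => //.
have [s sE] : exists s, g ** g = s by exists (g ** g).
have ss : star s = s by rewrite -sE star_sq.
have sb' : s ** b = b ** s by rewrite -sE -cmulA gbb cmulA gbb -cmulA.
have [d dE] : exists d, s - b = d by exists (s - b).
have sd : star d = d by rewrite -dE starB ss sb.
have db : d ** b = b ** d by rewrite -dE cmulBl cmulBr sb'.
have ds : d ** s = s ** d by rewrite -dE cmulBl cmulBr sb'.
have gs : g ** s = s ** g by rewrite -sE cmulA.
have gd : g ** d = d ** g by rewrite -dE cmulBl cmulBr gbb gs.
rewrite sE in gg.
have dsb : d ** s = - (d ** b).
  by rewrite -dE !cmulBl gg sb' opprB.
(* Here operator positivity enters: |g d x|^2 = - <d x, b d x> is at most 0. Then s d = b d = 0, so
   d^2 = 0 and [d] vanishes. *)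
have gd0 : g ** d = 0.
  apply: vna_ext => h k; congr hdot.
  have form x : nrm (vna_op (g ** d) x) = 0.
    have : hdot x (vna_op (star (g ** d) ** (g ** d)) x) = - hdot (vna_op d x) (vna_op b (vna_op d x)).
      have -> : star (g ** d) ** (g ** d) = - (d ** (b ** d)).
        by rewrite starM sd sg !cmulA -(cmulA d g g) sE dsb cmulNl.
      rewrite -sub0r vna_opB (linear0_fun (vna_op_linear x)) sub0r -scaleN1r hdotZr mulN1r.
      by rewrite vna_opM -{1}sd vna_op_starr vna_opM.
    rewrite vna_op_sq => e.
    have : ((nrm (vna_op (g ** d) x) ^+ 2)%:C <= 0)%C.
      by rewrite e oppr_le0.
    rewrite -(rmorph0 (real_complex R)) lecR => le0.
    by apply/eqP; rewrite -sqrf_eq0 eq_le le0 sqr_ge0.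
  by rewrite (nrm_eq0 (form k)) (linear0_fun (vna_op_linear k)).
have sd0 : s ** d = 0 by rewrite -sE -cmulA gd0 cmul0r.
have bd0 : b ** d = 0 by rewrite -db -[_ ** _]opprK -dsb ds sd0 oppr0.
have d0 : d = 0.
  have := nrm_sa_sq sd; rewrite -{1}dE cmulBl sd0 bd0 subr0 nrm0.
  by move=> /esym/eqP; rewrite expf_eq0 => /eqP/nrm_eq0.
by apply/eqP; rewrite eq_sym -subr_eq0 sE dE d0.
Qed.

Lemma vna_positive_elt b : star b = b ->
  (forall h, 0 <= hdot h (vna_op b h)) -> positive_elt b.
Proof.
move=> sb /(vna_positive_sqrt sb)[g [sg -> _]].
by apply/positive_eltP; exists g.
Qed.

(** For p = b^* b the element M^4 - p^2 is positive as an operator, hence is g^2 with [g] commuting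
    with [p]. From p^2 + g^2 = M^4, [sum_sq_bound] gives |p| <= M^2. *)
Lemma nrm_le_vna_op b (M : R) : 0 <= M ->
  (forall h, nrm (vna_op b h) <= M * nrm h) -> nrm b <= M.
Proof.
move=> M0 bM; pose p := star b ** b; have sp : star p = p by exact: star_cstar.
pose y := ((M ^+ 2) ^+ 2)%:C%C *: cone - p ** p.
have sy : star y = y by rewrite starB starZr star1 star_sq.
have y0 h : 0 <= hdot h (vna_op y h).
  rewrite vna_opB vna_opZ vna_op1 hdotBr hdotZr -{1}sp vna_op_sq hdot_nrm.
  rewrite -rmorphM -rmorphB ler0c subr_ge0 -exprMn ler_pXn2r ?nnegrE ?nrm_ge0 //.
    rewrite vna_opM expr2 -mulrA; apply: (le_trans (nrm_vna_op_star M0 bM _)).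
    by rewrite ler_wpM2l.
  by rewrite mulr_ge0 ?sqr_ge0 ?nrm_ge0.
have [g [sg yE gc]] := vna_positive_sqrt sy y0.
have py : y ** p = p ** y.
  by rewrite /y cmulBl cmulBr cmulZl cmulZr cmul1l cmul1r cmulA.
have : nrm p <= M ^+ 2.
  apply: (sum_sq_bound (q := g)) => //; last exact: sqr_ge0.
    by rewrite gc.
  by rewrite -yE addrC subrK.
by rewrite nrm_cstar ler_pXn2r // nnegrE nrm_ge0.
Qed.

(** [b] plays the role of f^* f, without an adjoint of [f] being formed. *)
Lemma gram_nrm_le (K : hilbertType R) (f : H -> K) b :
  (forall h k, hdot (f h) (f k) = hdot h (vna_op b k)) ->
  forall h, nrm (f h) <= Num.sqrt (nrm b) * nrm h.
Proof.
move=> fb h; rewrite -(@ler_pXn2r _ 2) ?nnegrE ?nrm_ge0 ?mulr_ge0 ?sqrtr_ge0 ?nrm_ge0 //.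
rewrite exprMn sqr_sqrtr ?nrm_ge0 // -lecR -hdot_nrm.
rewrite -[hdot _ _]ger0_norm; last by rewrite hdot_nrm ler0c sqr_ge0.
rewrite fb cabsE lecR; apply: (le_trans (cauchy_schwarz _ _)).
by rewrite mulrC expr2 mulrA ler_wpM2r ?nrm_ge0 // nrm_vna_op.
Qed.

Lemma nrm_le_gram (K : hilbertType R) (f : H -> K) b (M : R) : 0 <= M ->
  (forall h k, hdot (f h) (f k) = hdot h (vna_op b k)) ->
  (forall h, nrm (f h) <= M * nrm h) -> nrm b <= M ^+ 2.
Proof.
move=> M0 fb fM; apply: nrm_le_vna_op => [|h]; first exact: sqr_ge0.
set y := vna_op b h.
have := cauchy_schwarz (f y) (f h); rewrite fb -/y hdot_nrm.
have -> : cabs (nrm y ^+ 2)%:C%C = nrm y ^+ 2.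
  by rewrite /cabs ger0_norm // ler0c sqr_ge0.
have := fM y; have := fM h; have := nrm_ge0 y; have := nrm_ge0 h.
have := nrm_ge0 (f y); have := nrm_ge0 (f h).
set s := nrm y; set r := nrm h; set p := nrm _; set q := nrm _.
move=> p0 q0 r0 s0 h1 h2 h3.
have : s ^+ 2 <= (M * s) * (M * r) by apply: (le_trans h3); apply: ler_pM.
have Mr : 0 <= M ^+ 2 * r by rewrite mulr_ge0 ?sqr_ge0.
rewrite le_eqVlt in s0; case/predU1P: s0 => [<- _ //|s0].
have -> : M * s * (M * r) = s * (M ^+ 2 * r) by ring.
by rewrite expr2 ler_pM2l.
Qed.

End VonNeumannAlgebraTheory.

Section InteriorTensorTheory.
Variables (R : realType) (H : hilbertType R) (B : vonNeumannAlgebra H).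
Variables (E : preHilbertModType B) (t : interiorTensor E).
Implicit Types (x y : E) (h k : H) (b : B).

Notation K := (it_space t).
Notation "x (x) h" := (it_tens t x h) (at level 38).

Lemma tens_ext (z z' : K) :
  (forall x h, hdot (x (x) h) z = hdot (x (x) h) z') -> z = z'.
Proof.
by move=> zz; apply: (total_vec (it_total t)) => _ [x [h ->]].
Qed.

Lemma tensDl x y h : (x + y) (x) h = x (x) h + y (x) h.
Proof.
by apply: tens_ext => z k; rewrite hdotDr !it_dot ipDr vna_opD hdotDr.
Qed.

Lemma tensZl (c : complex R) x h : (c *: x) (x) h = c *: (x (x) h).
Proof.
by apply: tens_ext => z k; rewrite hdotZr !it_dot ipZr vna_opZ hdotZr.
Qed.

Lemma tensBl x y h : (x - y) (x) h = x (x) h - y (x) h.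
Proof. by rewrite tensDl -scaleN1r tensZl scaleN1r. Qed.

Lemma tens_lin x : linear (it_tens t x).
Proof.
move=> c h k; apply: tens_ext => z l.
by rewrite hdot_linear !it_dot (vna_op_lin (ip z x)) hdot_linear.
Qed.

Lemma tens_ract x b h : (ract x b) (x) h = x (x) (vna_op b h).
Proof. by apply: tens_ext => z k; rewrite !it_dot ip_ract vna_opM. Qed.

Lemma tens_inj x y : (forall h, x (x) h = y (x) h) -> x = y.
Proof.
move=> xy; apply/eqP; rewrite -subr_eq0; apply/eqP/ip_eq0.
apply: vna_ext => h k; rewrite -(it_dot t) tensBl xy subrr hdot0l.
by rewrite (linear0_fun (vna_op_linear k)) hdot0r.
Qed.

Lemma nrm_tens x h : nrm (x (x) h) <= nrm x * nrm h.
Proof.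
apply: (le_trans (gram_nrm_le (it_dot t x x) h)).
by rewrite nrm_ip sqrtr_sqr ger0_norm ?nrm_ge0.
Qed.

Lemma nrm_le_tens x (M : R) : 0 <= M ->
  (forall h, nrm (x (x) h) <= M * nrm h) -> nrm x <= M.
Proof.
move=> M0 /(nrm_le_gram M0 (it_dot t x x)); rewrite nrm_ip.
by rewrite ler_pXn2r ?nnegrE ?nrm_ge0.
Qed.

End InteriorTensorTheory.

(** * Hilbert spaces from Gram matrices *)

Section LinearSpan.
Variables (K : numFieldType) (V : lmodType K) (S : set V).

Lemma linear_spanZ (c : K) v : linear_span S v -> linear_span S (c *: v).
Proof.
move=> [n [d [s [Ss ->]]]]; exists n, (fun i => c * d i), s; split=> //.
by rewrite scaler_sumr; apply: eq_bigr => i _; rewrite scalerA.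
Qed.

Lemma linear_spanD v w : linear_span S v -> linear_span S w -> linear_span S (v + w).
Proof.
move=> [n [d [s [Ss ->]]]] [m [d' [s' [Ss' ->]]]].
exists (n + m)%N,
  (fun k : 'I_(n + m) => match fintype.split k with inl i => d i | inr j => d' j end),
  (fun k : 'I_(n + m) => match fintype.split k with inl i => s i | inr j => s' j end); split.
  by move=> k; case: fintype.split.
rewrite big_split_ord /=; congr (_ + _); apply: eq_bigr => i _.
  by rewrite (unsplitK (inl i)).
by rewrite (unsplitK (inr i)).
Qed.

Lemma linear_span0 : linear_span S 0.
Proof.
by exists 0%N, (fun _ => 0), (fun _ => 0); split=> [[]|] //; rewrite big_ord0.
Qed.

Lemma subset_linear_span : S `<=` linear_span S.
Proof.
move=> v Sv; exists 1%N, (fun _ => 1), (fun _ => v); split=> //.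
by rewrite big_ord1 scale1r.
Qed.

End LinearSpan.

Section HilbertSpan.
Variables (R : realType) (V : hilbertType R) (n : nat) (X : Type).
Variable iota : X -> 'I_n -> V.
Implicit Types (x : X) (e : R).

Definition fvec x : {ffun 'I_n -> V} := [ffun i => iota x i].

Definition fspan := linear_span [set y | exists x, y = fvec x].

(** The closed span in V^n, with approximation tested in each component. A closed subspace of V^n is
    complete, and the Gram matrix of its generators is the sum of the n component Gram matrices. *)
Definition hspan_pred : {pred {ffun 'I_n -> V}} := fun g => `[< forall e : R, 0 < e ->
  exists2 y, fspan y & forall i, nrm (g i - y i) < e >].

Lemma hspan_submod : GRing.submod_closed hspan_pred.
Proof.
split; first by apply/asboolP => e e0; exists 0; [exact: linear_span0 | move=> i; rewrite subrr nrm0].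
move=> c f g /asboolP hf /asboolP hg; apply/asboolP => e e0.
have c0 : 0 < cabs c + 1 by have := cabs_ge0 c; lra.
have [y Sy fy] := hf (e / 2 / (cabs c + 1)) ltac:(by rewrite !divr_gt0).
have [z Sz gz] := hg (e / 2) ltac:(lra).
exists (c *: y + z); first exact/linear_spanD/Sz/linear_spanZ.
move=> i; rewrite !ffunE opprD addrACA -scalerBr.
apply: (le_lt_trans (nrmD _ _)); rewrite nrmZ -/(cabs c).
have := gz i; have := fy i; rewrite ltr_pdivlMr //.
by have := nrm_ge0 (f i - y i); have := cabs_ge0 c; nra.
Qed.

HB.instance Definition _ := GRing.isSubmodClosed.Build (complex R) {ffun 'I_n -> V}
  hspan_pred hspan_submod.

Record hspan := HSpan { hspan_val : {ffun 'I_n -> V}; _ : hspan_val \in hspan_pred }.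

HB.instance Definition _ := [isSub for hspan_val].
HB.instance Definition _ := [Choice of hspan by <:].
HB.instance Definition _ := [SubChoice_isSubLmodule of hspan by <:].

Definition hcomp (i : 'I_n) (f : hspan) : V := val f i.

Lemma hcomp_linear i : linear (hcomp i).
Proof. by move=> c f g; rewrite /hcomp linearP !ffunE. Qed.

Lemma hspan_ext (f g : hspan) : (forall i, hcomp i f = hcomp i g) -> f = g.
Proof. by move=> fg; apply/val_inj/ffunP. Qed.

Definition hspan_dot (f g : hspan) := \sum_i hdot (hcomp i f) (hcomp i g).

Definition hspan_norm (f : hspan) : R := Num.sqrt (\sum_i nrm (hcomp i f) ^+ 2).

Let sum_sq_ge0 (f : hspan) : 0 <= \sum_i nrm (hcomp i f) ^+ 2.
Proof. by apply: sumr_ge0 => i _; exact: sqr_ge0. Qed.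

Lemma hspan_dotC f g : hspan_dot g f = (hspan_dot f g)^*.
Proof.
by rewrite /hspan_dot rmorph_sum /=; apply: eq_bigr => i _; rewrite -hdotC.
Qed.

Lemma hspan_dot_linear f (c : complex R) g h :
  hspan_dot f (c *: g + h) = c * hspan_dot f g + hspan_dot f h.
Proof.
rewrite /hspan_dot mulr_sumr -big_split; apply: eq_bigr => i _ /=.
by rewrite hcomp_linear hdot_linear.
Qed.

Lemma hspan_norm_ge0 f : 0 <= hspan_norm f.
Proof. exact: sqrtr_ge0. Qed.

Lemma hspan_dot_norm f : hspan_dot f f = (hspan_norm f ^+ 2)%:C%C.
Proof.
rewrite sqr_sqrtr // rmorph_sum; apply: eq_bigr => i _.
by rewrite hdot_nrm.
Qed.

Lemma nrm_hcomp i f : nrm (hcomp i f) <= hspan_norm f.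
Proof.
rewrite -(@ler_pXn2r _ 2) ?nnegrE ?nrm_ge0 ?hspan_norm_ge0 // sqr_sqrtr //.
by rewrite (bigD1 i) //= lerDl; apply: sumr_ge0 => j _; exact: sqr_ge0.
Qed.

Lemma hspan_norm_eq0 f : hspan_norm f = 0 -> f = 0.
Proof.
move=> f0; apply: hspan_ext => i; rewrite (linear0_fun (hcomp_linear i)).
by apply/nrm_eq0/le_anti; rewrite nrm_ge0 andbT -f0 nrm_hcomp.
Qed.

Lemma hspan_norm_le f e : 0 <= e -> (forall i, nrm (hcomp i f) <= e) ->
  hspan_norm f <= n%:R * e.
Proof.
move=> e0 fe; rewrite -(@ler_pXn2r _ 2) ?nnegrE ?mulr_ge0 ?hspan_norm_ge0 //.
rewrite sqr_sqrtr //; apply: (@le_trans _ _ (\sum_(i < n) e ^+ 2)).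
  by apply: ler_sum => i _; rewrite ler_pXn2r ?nnegrE ?nrm_ge0.
rewrite sumr_const card_ord -[X in X <= _]mulr_natl exprMn ler_wpM2r ?sqr_ge0 //.
by rewrite -natrX ler_nat -mulnn; case: (n) => // m; rewrite leq_pmulr.
Qed.

Let cnorm (f : hspan) : complex R := (hspan_norm f)%:C%C.

Let cnormD f g : cnorm (f + g) <= cnorm f + cnorm g.
Proof.
rewrite -rmorphD lecR; apply: (form_triangle hspan_dotC hspan_dot_linear
  hspan_norm_ge0 hspan_dot_norm hspan_norm_eq0).
Qed.

Let cnormZ (c : complex R) f : cnorm (c *: f) = `|c| * cnorm f.
Proof.
rewrite cabsE -rmorphM; congr (_%:C)%C; apply: (form_homogeneous hspan_dotC
  hspan_dot_linear hspan_norm_ge0 hspan_dot_norm).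
Qed.

Let cnorm_eq0 f : cnorm f = 0 -> f = 0.
Proof. by move=> /complexI; exact: hspan_norm_eq0. Qed.

HB.instance Definition _ := Lmodule_isNormed.Build (complex R) hspan
  cnormD cnormZ cnorm_eq0.

Lemma nrm_hspan f : nrm f = hspan_norm f.
Proof. by []. Qed.

Lemma hspan_complete (F : set_system hspan) : ProperFilter F -> cauchy F -> cvg F.
Proof.
move=> FF cF.
have cFi i : cvg (hcomp i @ F).
  apply/cauchy_cvgP/cauchy_exP => e e0.
  have /cauchyP/(_ e e0)[f Ff] := cF.
  exists (hcomp i f); apply: (@filterS _ F _ _ _ _ Ff) => g.
  rewrite -!ball_normE /= (ge0_complexRe (ltW e0)) !nrmE !ltcR nrm_hspan.
  by apply: le_lt_trans; rewrite -linearB_fun ?nrm_hcomp //; exact: hcomp_linear.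
pose l := [ffun i => lim (hcomp i @ F)].
have Fl e : 0 < e -> \forall g \near F, forall i, nrm (l i - hcomp i g) < e.
  move=> e0; apply: filter_forall => i; rewrite ffunE.
  by have /near_nrm := cFi i; exact.
have l_in : l \in hspan_pred.
  apply/asboolP => e e0; have e2 : 0 < e / 2 by rewrite divr_gt0.
  have [g gl] := filter_ex (Fl _ e2).
  have /asboolP/(_ _ e2)[y Sy gy] := valP g.
  exists y => // i; apply: (le_lt_trans (nrm_sub_trans (hcomp i g) _ _)).
  by have := gl i; have := gy i; rewrite -/(hcomp i g); lra.
apply/cvg_ex; exists (HSpan l_in); apply/near_nrm => e e0.
have n0 : 0 < n%:R + 1 :> R by rewrite ltr_wpDl.
apply: filterS (Fl (e / (n%:R + 1)) (divr_gt0 e0 n0)) => g gl.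
rewrite nrm_hspan; apply: (@le_lt_trans _ _ (n%:R * (e / (n%:R + 1)))).
  apply: hspan_norm_le; first by rewrite divr_ge0 // ltW.
  by move=> i; rewrite (linearB_fun _ _ (hcomp_linear i)) ltW //; exact: gl.
by rewrite mulrA ltr_pdivrMr // mulrDr mulrC mulr1; lra.
Qed.

HB.instance Definition _ := Uniform_isComplete.Build hspan hspan_complete.

Let hspan_dot_cnorm f : hspan_dot f f = `|f| ^+ 2.
Proof. by rewrite hspan_dot_norm rmorphXn. Qed.

HB.instance Definition _ := isHilbert.Build R hspan
  hspan_dotC hspan_dot_linear hspan_dot_cnorm.

Lemma fvec_in x : fvec x \in hspan_pred.
Proof.
apply/asboolP => e e0; exists (fvec x); last by move=> i; rewrite subrr nrm0.
by apply: subset_linear_span; exists x.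
Qed.

Definition hgen x : hspan := HSpan (fvec_in x).

Lemma hcomp_gen i x : hcomp i (hgen x) = iota x i.
Proof. by rewrite /hcomp ffunE. Qed.

Lemma hdot_hspan (f g : hspan) : hdot f g = \sum_i hdot (hcomp i f) (hcomp i g).
Proof. by []. Qed.

Lemma hcomp_bounded i : bounded_linear (hcomp i).
Proof.
apply/bounded_linearP; split; first exact: hcomp_linear.
by exists 1 => // f; rewrite mul1r nrm_hcomp.
Qed.

Lemma hgen_total : closure (linear_span [set f | exists x, f = hgen x]) = [set: hspan].
Proof.
apply/seteqP; split=> // f _; apply/closure_nrmP => e e0.
have n0 : 0 < n%:R + 1 :> R by rewrite ltr_wpDl.
have /asboolP/(_ _ (divr_gt0 e0 n0))[y [m [c [s [/choice[x sx] yE]]]] fy] := valP f.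
exists (\sum_(j < m) c j *: hgen (x j)).
  by exists m, c, (fun j => hgen (x j)); split=> // j; exists (x j).
rewrite nrm_hspan; apply: (@le_lt_trans _ _ (n%:R * (e / (n%:R + 1)))).
  apply: hspan_norm_le => [|i]; first by rewrite divr_ge0 // ltW.
  rewrite (linearB_fun _ _ (hcomp_linear i)) ltW //.
  apply: le_lt_trans (fy i); rewrite le_eqVlt; apply/orP; left; apply/eqP.
  congr (nrm (_ - _)); rewrite (linear_sum_fun _ _ (hcomp_linear i)) yE sum_ffunE.
  apply: eq_bigr => j _; rewrite (linearZ_fun _ _ (hcomp_linear i)) sx.
  by rewrite !ffunE hcomp_gen.
by rewrite mulrA ltr_pdivrMr // mulrDr mulrC mulr1; lra.
Qed.

End HilbertSpan.

(** * Bounded operators prescribed on a total family *)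

Section Extension.
Variables (R : realType) (K W W' : hilbertType R) (X : Type).
Variables (kappa : X -> K) (phi : X -> W) (psi : X -> W') (M : R).
Hypothesis M_ge0 : 0 <= M.
Hypothesis kappa_total : closure (linear_span [set f | exists x, f = kappa x]) = [set: K].
Hypothesis gram : forall x y,
  hdot (phi x) (phi y) + hdot (psi x) (psi y) = (M ^+ 2)%:C%C * hdot (kappa x) (kappa y).

(** The vectors [kappa x] may be linearly dependent, so the operator is first a relation: the
    closure of this span, which [graph_bound] makes single-valued and completeness of W makes
    total. *)
Let graph := linear_span [set p : K * W | exists x, p = (kappa x, phi x)].

Let fst_lin : linear (fst : K * W -> K). Proof. by []. Qed.
Let snd_lin : linear (snd : K * W -> W). Proof. by []. Qed.

Let graph_comb N (c : 'I_N -> complex R) (x : 'I_N -> X) :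
  (\sum_i c i *: (kappa (x i), phi (x i))).1 = \sum_i c i *: kappa (x i) /\
  (\sum_i c i *: (kappa (x i), phi (x i))).2 = \sum_i c i *: phi (x i).
Proof.
by rewrite (linear_sum_fun _ _ fst_lin) (linear_sum_fun _ _ snd_lin).
Qed.

Let graph_bound p : graph p -> nrm p.2 <= M * nrm p.1.
Proof.
move=> [N [c [s [/choice[x sx] ->]]]].
have -> : \sum_(i < N) c i *: s i = \sum_i c i *: (kappa (x i), phi (x i)).
  by apply: eq_bigr => i _; rewrite sx.
have [-> ->] := graph_comb c x.
have hdot_comb (U : hilbertType R) (f : X -> U) :
    (nrm (\sum_i c i *: f (x i)) ^+ 2)%:C%C =
    \sum_i \sum_j (c i)^* * c j * hdot (f (x i)) (f (x j)).
  rewrite -hdot_nrm hdot_suml; apply: eq_bigr => i _.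
  by rewrite hdot_sumr; apply: eq_bigr => j _; rewrite hdotZl hdotZr mulrA.
have h : nrm (\sum_i c i *: phi (x i)) ^+ 2 + nrm (\sum_i c i *: psi (x i)) ^+ 2 =
    M ^+ 2 * nrm (\sum_i c i *: kappa (x i)) ^+ 2.
  apply: complexI; rewrite rmorphD [RHS]rmorphM /= !hdot_comb -big_split mulr_sumr.
  apply: eq_bigr => i _ /=; rewrite -big_split mulr_sumr; apply: eq_bigr => j _ /=.
  by rewrite -mulrDr gram mulrCA.
rewrite -(@ler_pXn2r _ 2) ?nnegrE ?mulr_ge0 ?nrm_ge0 // exprMn -h lerDl.
exact: sqr_ge0.
Qed.

Let rel f g := forall e : R, 0 < e ->
  exists2 p, graph p & nrm (f - p.1) < e /\ nrm (g - p.2) < e.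

Let rel_bound f g : rel f g -> nrm g <= M * nrm f.
Proof.
move=> fg; apply/ler_addgt0Pr => e e0.
have M0 := M_ge0; have M1 : 0 < M + 1 by lra.
have [p Gp [fp gp]] := fg (e / (M + 1)) (divr_gt0 e0 M1).
have := graph_bound Gp.
have := nrm_sub_trans f p.1 0; have := nrm_sub_trans p.2 g 0.
rewrite !subr0 (nrmC p.1) => gp2 p1f p21.
have eE : e = M * (e / (M + 1)) + e / (M + 1) by field; rewrite gt_eqF.
have h1 : M * nrm p.1 <= M * (nrm (f - p.1) + nrm f) by rewrite ler_wpM2l.
have h2 : M * nrm (f - p.1) <= M * (e / (M + 1)) by rewrite ler_wpM2l // ltW.
by rewrite eE; lra.
Qed.

Let rel_linear c f g f' g' : rel f g -> rel f' g' -> rel (c *: f + f') (c *: g + g').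
Proof.
move=> fg fg' e e0; have c0 : 0 < cabs c + 1 by have := cabs_ge0 c; lra.
have e2 : 0 < e / 2 by rewrite divr_gt0.
have [p Gp [fp gp]] := fg _ (divr_gt0 e2 c0).
have [q Gq [fq gq]] := fg' _ e2.
exists (c *: p + q); first exact/linear_spanD/Gq/linear_spanZ.
have comb (U : normedModType (complex R)) (u u' v v' : U) :
    nrm (u - v) < e / 2 / (cabs c + 1) -> nrm (u' - v') < e / 2 ->
    nrm (c *: u + u' - (c *: v + v')) < e.
  rewrite ltr_pdivlMr // opprD addrACA -scalerBr => uv uv'.
  apply: (le_lt_trans (nrmD _ _)); rewrite nrmZ -/(cabs c).
  by have := nrm_ge0 (u - v); have := cabs_ge0 c; nra.
by split; exact: comb.
Qed.

Let rel_fun f g g' : rel f g -> rel f g' -> g = g'.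
Proof.
move=> fg fg'; apply/eqP; rewrite -subr_eq0; apply/eqP/nrm_eq0.
have := rel_bound (rel_linear (-1) fg' fg).
rewrite !scaleN1r addNr nrm0 mulr0 [_ + g]addrC => h.
by apply/le_anti; rewrite h nrm_ge0.
Qed.

Let rel_ex f : exists g, rel f g.
Proof.
have approx e : 0 < e -> exists2 p, graph p & nrm (f - p.1) < e.
  move=> e0; have /closure_nrmP/(_ e e0)[_ [N [c [s [/choice[x sx] ->]]]] fs] :
      closure (linear_span [set f | exists x, f = kappa x]) f by rewrite kappa_total.
  exists (\sum_i c i *: (kappa (x i), phi (x i))).
    by exists N, c, (fun i => (kappa (x i), phi (x i))); split=> // i; exists (x i).
  rewrite (graph_comb c x).1; apply: le_lt_trans fs; rewrite le_eqVlt; apply/orP; left.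
  by apply/eqP; congr (nrm (_ - _)); apply: eq_bigr => i _; rewrite sx.
have inv0 m : 0 < (m.+1%:R)^-1 :> R by rewrite invr_gt0.
have /choice[p Gp] : forall m, exists p, graph p /\ nrm (f - p.1) < (m.+1%:R)^-1.
  by move=> m; have [p] := approx _ (inv0 m); exists p.
have small e : 0 < e -> exists N, forall m, (N <= m)%N -> (m.+1%:R)^-1 < e :> R.
  move=> e0; exists (Num.truncn e^-1) => m Nm.
  rewrite invf_plt ?posrE // (lt_le_trans (truncnS_gt _)) // ler_nat ltnS.
  exact: Nm.
have M0 := M_ge0; have M2 : 0 < 2 * M + 1 by lra.
have [|g pg] := @complete_limit R W (fun m => (p m).2).
  move=> e e0; have [N NP] := small _ (divr_gt0 e0 M2); exists N => m k Nm Nk.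
  have Gd : graph (p m - p k).
    by rewrite addrC -scaleN1r; apply/linear_spanD; [apply: linear_spanZ|]; case: (Gp k); case: (Gp m).
  apply: (le_lt_trans (graph_bound Gd)) => /=.
  have := NP m Nm; have := NP k Nk; have := (Gp m).2; have := (Gp k).2.
  have := nrm_sub_trans f (p m).1 (p k).1; rewrite (nrmC (p m).1 f).
  have := nrm_ge0 ((p m).1 - (p k).1).
  set a := nrm _; set b := nrm _; set c := nrm _.
  move: (k.+1%:R^-1 : R) (m.+1%:R^-1 : R) => d d' a0 abc cd bd dk dm.
  have eE : e = 2 * M * (e / (2 * M + 1)) + e / (2 * M + 1) by field; rewrite gt_eqF.
  move: (e / _) eE dk dm => r -> dk dm.
  have ar : a < 2 * r by lra.
  have : M * a <= M * (2 * r) by rewrite ler_wpM2l // ltW.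
  by lra.
exists g => e e0; have [N NP] := small e e0; have [N' N'P] := pg e e0.
exists (p (maxn N N')); first by case: (Gp (maxn N N')).
split; last by rewrite nrmC N'P // leq_maxr.
by apply: lt_trans (Gp _).2 _; apply: NP; exact: leq_maxl.
Qed.

(** [psi] is the defect: its Gram matrix fills the gap between that of [phi] and M^2 times that of
    [kappa], so on linear combinations the bound results from dropping a square. *)
Lemma gram_extension : exists Phi : K -> W,
  [/\ linear Phi, forall f, nrm (Phi f) <= M * nrm f & forall x, Phi (kappa x) = phi x].
Proof.
have [Phi PhiP] := choice rel_ex.
exists Phi; split=> [c f g|f|x]; last 1 first.
- apply: (rel_fun (PhiP _)) => e e0; exists (kappa x, phi x); last by rewrite !subrr !nrm0.
  by apply: subset_linear_span; exists x.
- by apply: (rel_fun (PhiP _)); exact: rel_linear.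
- exact: rel_bound.
Qed.

End Extension.

(** * Von Neumann modules of operators *)

Section OperatorModule.
Variables (R : realType) (H : hilbertType R) (B : vonNeumannAlgebra H).
Variable K : hilbertType R.

(* The data of a strongly closed B-submodule of B(H, K) whose inner products
   X^* Y lie in B; every von Neumann B-module arises in this way. *)
Record opspace := OpSpace {
  os_set : set (H -> K);
  os_bounded : forall X, os_set X -> bounded_linear X;
  os0 : os_set (fun _ => 0);
  os_lin : forall (c : complex R) X Y, os_set X -> os_set Y ->
    os_set (fun h => c *: X h + Y h);
  os_ract : forall X (b : B), os_set X -> os_set (X \o vna_op b);
  os_gram : forall X Y, os_set X -> os_set Y ->
    exists b : B, forall h k, hdot (X h) (Y k) = hdot h (vna_op b k);
  os_closed : strongly_closed os_set;
  os_total : closure (linear_span [set z | exists X h, os_set X /\ z = X h])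
             = [set: K]
}.

Variable D : opspace.

Definition opmod_pred : {pred (H -> K)} := fun X => `[< os_set D X >].

Lemma opmod_submod : GRing.submod_closed opmod_pred.
Proof.
split; first by apply/asboolP; exact: os0.
by move=> c X Y /asboolP DX /asboolP DY; apply/asboolP; exact: os_lin.
Qed.

HB.instance Definition _ := GRing.isSubmodClosed.Build (complex R) (H -> K)
  opmod_pred opmod_submod.

Record opmod := OpMod { op : H -> K; _ : op \in opmod_pred }.

HB.instance Definition _ := [isSub for op].
HB.instance Definition _ := [Choice of opmod by <:].
HB.instance Definition _ := [SubChoice_isSubLmodule of opmod by <:].

Implicit Types (X Y Z : opmod) (h k : H) (b : B).

Lemma opP X : os_set D (op X).
Proof. exact/asboolP/(valP X). Qed.

Definition opmod_of (X : H -> K) (DX : os_set D X) : opmod := OpMod (asboolT DX).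

Lemma op_inj X Y : op X =1 op Y -> X = Y.
Proof. by move=> XY; apply/val_inj/funext. Qed.

Lemma opD X Y h : op (X + Y) h = op X h + op Y h.
Proof. by []. Qed.

Lemma opZ (c : complex R) X h : op (c *: X) h = c *: op X h.
Proof. by []. Qed.

Definition opmod_ip X Y : B := sval (cid (os_gram (opP X) (opP Y))).

Lemma op_dot X Y h k : hdot (op X h) (op Y k) = hdot h (vna_op (opmod_ip X Y) k).
Proof. by rewrite /opmod_ip; case: cid => b bP /=; exact: bP. Qed.

Definition opmod_ract X b := opmod_of (os_ract b (opP X)).

(** Defined from the inner product so that [ip_norm] holds by construction. [q_op] and [q_le] show
    that it is the operator norm, and this gives the triangle inequality. *)
Let q X : R := Num.sqrt (nrm (opmod_ip X X)).

Let q_op X h : nrm (op X h) <= q X * nrm h.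
Proof. exact/gram_nrm_le/op_dot. Qed.

Let q_le X (M : R) : 0 <= M -> (forall h, nrm (op X h) <= M * nrm h) -> q X <= M.
Proof.
move=> M0 XM; have := nrm_le_gram M0 (op_dot X X) XM.
by rewrite -(@ler_pXn2r _ 2 _ (q X)) ?nnegrE ?sqrtr_ge0 // sqr_sqrtr ?nrm_ge0.
Qed.

Let cnorm X : complex R := (q X)%:C%C.

Let cnormD X Y : cnorm (X + Y) <= cnorm X + cnorm Y.
Proof.
rewrite -rmorphD lecR; apply: q_le => [|h]; first by rewrite addr_ge0 ?sqrtr_ge0.
rewrite opD mulrDl; apply: (le_trans (nrmD _ _)).
by rewrite lerD ?q_op.
Qed.

Let ip_linear_ X (c : complex R) Y Z :
  opmod_ip X (c *: Y + Z) = c *: opmod_ip X Y + opmod_ip X Z.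
Proof.
apply: vna_ext => h k; rewrite vna_opD vna_opZ [RHS]hdot_linear -!op_dot.
by rewrite opD opZ hdot_linear.
Qed.

Let ip_star_ X Y : star (opmod_ip X Y) = opmod_ip Y X.
Proof.
apply: vna_ext => h k.
by rewrite vna_op_starr hdotC -op_dot -hdotC op_dot.
Qed.

Let cnormZ (c : complex R) X : cnorm (c *: X) = `|c| * cnorm X.
Proof.
have ipc : opmod_ip (c *: X) (c *: X) = `|c| ^+ 2 *: opmod_ip X X.
  apply: vna_ext => h k.
  by rewrite -op_dot !opZ hdotZl hdotZr mulrA -normCKC vna_opZ hdotZr op_dot.
rewrite /cnorm /q ipc cabsE -rmorphXn nrmZr ger0_norm ?sqr_ge0 //.
by rewrite sqrtrM ?sqr_ge0 // sqrtr_sqr ger0_norm ?cabs_ge0 // rmorphM.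
Qed.

Let cnorm_eq0 X : cnorm X = 0 -> X = 0.
Proof.
move=> /complexI X0; apply: op_inj => h; apply/nrm_eq0/le_anti.
by rewrite nrm_ge0 andbT (le_trans (q_op X h)) // X0 mul0r.
Qed.

HB.instance Definition _ := Lmodule_isNormed.Build (complex R) opmod
  cnormD cnormZ cnorm_eq0.

Let ractDl_ X Y b : opmod_ract (X + Y) b = opmod_ract X b + opmod_ract Y b.
Proof. exact: op_inj. Qed.

Let op_lin X : linear (op X).
Proof. by have /os_bounded/bounded_linearP[] := opP X. Qed.

Let ractDr_ X a b : opmod_ract X (a + b) = opmod_ract X a + opmod_ract X b.
Proof.
by apply: op_inj => h; rewrite opD /= vna_opD (linearD_fun _ _ (op_lin X)).
Qed.

Let ractZl_ (c : complex R) X b : opmod_ract (c *: X) b = c *: opmod_ract X b.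
Proof. exact: op_inj. Qed.

Let ractZr_ (c : complex R) X b : opmod_ract X (c *: b) = c *: opmod_ract X b.
Proof.
by apply: op_inj => h; rewrite opZ /= vna_opZ (linearZ_fun _ _ (op_lin X)).
Qed.

Let ractM_ X a b : opmod_ract X (a ** b) = opmod_ract (opmod_ract X a) b.
Proof. by apply: op_inj => h /=; rewrite vna_opM. Qed.

Let ract1_ X : opmod_ract X cone = X.
Proof. by apply: op_inj => h /=; rewrite vna_op1. Qed.

Let ip_ract_ X Y b : opmod_ip X (opmod_ract Y b) = opmod_ip X Y ** b.
Proof. by apply: vna_ext => h k; rewrite -op_dot /= op_dot vna_opM. Qed.

Let ip_pos_ X : positive_elt (opmod_ip X X).
Proof.
apply: vna_positive_elt; first exact: ip_star_.
by move=> h; rewrite -op_dot hdot_nrm ler0c sqr_ge0.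
Qed.

Let ip_norm_ X : `|opmod_ip X X| = `|X| ^+ 2.
Proof.
by rewrite nrmE [in RHS]/Num.norm /= /cnorm -rmorphXn /q sqr_sqrtr // nrm_ge0.
Qed.

HB.instance Definition _ := @isPreHilbertModule.Build R B opmod
  opmod_ract opmod_ip ractDl_ ractDr_ ractZl_ ractZr_ ractM_ ract1_
  ip_linear_ ip_ract_ ip_star_ ip_pos_ ip_norm_.

Let opmod_total :
  closure (linear_span [set z | exists (X : opmod) h, z = op X h]) = [set: K].
Proof.
rewrite -(os_total D); congr (closure (linear_span _)).
apply/seteqP; split=> z [X [h]] => [->|[DX ->]].
  by exists (op X), h; split=> //; exact: opP.
by exists (opmod_of DX), h.
Qed.

Definition opmod_tensor : interiorTensor opmod :=
  @InteriorTensor R H B opmod K op op_dot opmod_total.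

Let opmod_closed : strongly_closed (range (it_tens opmod_tensor)).
Proof.
have -> : range (it_tens opmod_tensor) = os_set D.
  apply/seteqP; split=> [_ [X _ <-]|X DX]; first exact: opP.
  by exists (opmod_of DX).
exact: os_closed.
Qed.

Definition opmod_vnm : vonNeumannModule B :=
  @VonNeumannModule R H B opmod opmod_tensor opmod_closed.

End OperatorModule.

(** * Pointwise convergence and strong closures *)

Lemma ptws_cvg (U : Type) (V : topologicalType) (F : set_system (U -> V))
    (FF : Filter F) (f : U -> V) :
  (forall u, (fun X : U -> V => X u) @ F --> f u) -> {ptws, F --> f}.
Proof.
move=> Ff; apply/cvg_sup => u N [A] [[Q] Qo <-] QX QN.
by apply: (filterS QN); apply: Ff; exact: open_nbhs_nbhs.
Qed.

Section StrongClosure.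
Variable R : realType.

Lemma bounded_linear_continuous (U V : normedModType (complex R)) (f : U -> V) : bounded_linear f -> continuous f.
Proof.
move=> /bounded_linearP[lf [M M0 fM]] x; apply/near_nrm => e e0.
have M1 : 0 < M + 1 by lra.
have /near_nrm/(_ _ (divr_gt0 e0 M1)) : nbhs x --> x by [].
apply: filterS => y; rewrite ltr_pdivlMr // -(linearB_fun _ _ lf) => xy.
by apply: le_lt_trans (fM _) _; have := nrm_ge0 (x - y); nra.
Qed.

(** Left composition with a bounded operator is continuous for pointwise convergence. Strong
    closedness of E thereby passes to [pullback]. *)
Lemma closure_comp (U V W : normedModType (complex R)) (f : V -> W) (S : set (U -> V)) (S' : set (U -> W)) X :
  bounded_linear f -> (forall Y, S Y -> S' (f \o Y)) ->
  closure (S : set {ptws U -> V}) X -> closure (S' : set {ptws U -> W}) (f \o X).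
Proof.
move=> bf SS' clS A A_X; have cf : continuous f by apply: bounded_linear_continuous.
have evX u : (fun Y : U -> V => Y u) @ (nbhs (X : {ptws U -> V})) --> X u.
  exact: (@proj_continuous U (fun _ => V) u X).
have FF : Filter ((fun Y : U -> V => f \o Y) @ (nbhs (X : {ptws U -> V}))).
  exact: (@fmap_filter _ _ _ _ (@nbhs_filter {ptws U -> V} X)).
have fX : {ptws, (fun Y : U -> V => f \o Y) @ (nbhs (X : {ptws U -> V})) --> f \o X}.
  by apply: ptws_cvg => u Q /cf/evX.
have [Y [SY AY]] := clS _ (fX A A_X).
by exists (f \o Y); split=> //; exact: SS'.
Qed.

End StrongClosure.

(** * Corners *)

Lemma linear_span_subset (K : numFieldType) (V : lmodType K) (S S' : set V) :
  S `<=` S' -> linear_span S `<=` linear_span S'.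
Proof.
by move=> SS' v [n [c [s [Ss ->]]]]; exists n, c, s; split=> // i; exact: SS'.
Qed.

Section Pullback.
Variables (R : realType) (H : hilbertType R) (B : vonNeumannAlgebra H).
Variables (E : vonNeumannModule B) (K : hilbertType R) (J : Type).
Variable Phi : J -> K -> it_space (vnm_tensor E).

(* Operators whose images under all the [Phi j] are of the form L_y: since E is
   strongly closed, so is this set. *)
Definition pullback : set (H -> K) := [set X | bounded_linear X /\
  forall j, exists y : E, forall h, Phi j (X h) = tens y h].

Hypothesis Phi_bounded : forall j, bounded_linear (Phi j).
Variables (n : nat) (z : 'I_n -> J).
Hypothesis frame : forall f g : K,
  hdot f g = \sum_i hdot (Phi (z i) f) (Phi (z i) g).
Hypothesis pullback_total :
  closure (linear_span [set f | exists X h, pullback X /\ f = X h]) = [set: K].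

Let Phi_lin j : linear (Phi j).
Proof. by have /bounded_linearP[] := Phi_bounded j. Qed.

Let pullback_bounded X : pullback X -> bounded_linear X.
Proof. by case. Qed.

Let pullback0 : pullback (fun _ => 0).
Proof.
split; first by apply/bounded_linearP; split=> [c x y|]; [rewrite scaler0 addr0 |
  exists 0 => // x; rewrite nrm0 mul0r].
move=> j; exists 0 => h; rewrite (linear0_fun (Phi_lin j)).
by rewrite -(scale0r (0 : E)) /tens tensZl scale0r.
Qed.

Let pullback_lin (c : complex R) X Y : pullback X -> pullback Y ->
  pullback (fun h => c *: X h + Y h).
Proof.
move=> [bX Xj] [bY Yj]; split; first exact: bounded_linear_comb.
move=> j; have [x xX] := Xj j; have [y yY] := Yj j.
by exists (c *: x + y) => h; rewrite (Phi_lin j) xX yY /tens tensDl tensZl.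
Qed.

Let pullback_ract X (b : B) : pullback X -> pullback (X \o vna_op b).
Proof.
move=> [bX Xj]; split; first by apply: bounded_linear_comp bX; exact: vna_op_bounded.
move=> j; have [x xX] := Xj j.
by exists (ract x b) => h; rewrite /= xX /tens tens_ract.
Qed.

Let pullback_gram X Y : pullback X -> pullback Y ->
  exists b : B, forall h k, hdot (X h) (Y k) = hdot h (vna_op b k).
Proof.
move=> [_ Xj] [_ Yj].
have [x xX] := choice (fun i => Xj (z i)); have [y yY] := choice (fun i => Yj (z i)).
exists (\sum_i ip (x i) (y i)) => h k.
rewrite frame vna_op_sum hdot_sumr; apply: eq_bigr => i _.
by rewrite xX yY it_dot.
Qed.

Let pullback_closed : strongly_closed pullback.
Proof.
move=> f bf clf; split=> // j.
have [||y _ yf] := @vnm_closed R H B E (Phi j \o f).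
- exact: bounded_linear_comp bf _.
- apply: (closure_comp (Phi_bounded j) _ clf) => Y [_ /(_ j)[y yY]].
  by exists y => //; apply/funext => h; rewrite /= yY.
- by exists y => h; rewrite /tens yf.
Qed.

Definition pullback_opspace : opspace B K :=
  OpSpace pullback_bounded pullback0 pullback_lin pullback_ract pullback_gram
    pullback_closed pullback_total.

End Pullback.

Section Corner.
Variables (R : realType) (H : hilbertType R) (B : vonNeumannAlgebra H).
Variables (E : vonNeumannModule B) (p : adjointable E E).
Hypothesis p_sa : forall x y, ip (p x) y = ip x (p y).
Hypothesis p_idem : forall x, p (p x) = p x.

(** With a single component, [hspan] is the closure of p E (x) H inside E (x) H, and [j] below is
    its inclusion. *)
Let iota (yh : E * H) (i : 'I_1) := tens (p yh.1) yh.2.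

Let K : hilbertType R := hspan iota.

Let j (_ : unit) (f : K) : it_space (vnm_tensor E) := hcomp ord0 f.

Let gen (y : E) (h : H) : K := hgen iota (y, h).

Let j_gen y h : j tt (gen y h) = tens (p y) h.
Proof. by rewrite /j hcomp_gen. Qed.

Let dotE (f g : K) : hdot f g = hdot (j tt f) (j tt g).
Proof. by rewrite hdot_hspan big_ord1. Qed.

Let frame1 (f g : K) : hdot f g = \sum_(i < 1) hdot (j tt f) (j tt g).
Proof. by rewrite big_ord1 dotE. Qed.

Let j_bounded u : bounded_linear (j u).
Proof. exact: hcomp_bounded. Qed.

Let j_inj (f g : K) : j tt f = j tt g -> f = g.
Proof. by move=> fg; apply: hspan_ext => i; rewrite ord1. Qed.

Let nrm_j (f : K) : nrm (j tt f) = nrm f.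
Proof.
apply/eqP; rewrite -(@eqrXn2 _ 2) ?nrm_ge0 //; apply/eqP.
by apply: complexI; rewrite -!hdot_nrm dotE.
Qed.

Let gen_pullback y : pullback j (gen y).
Proof.
split; last by case; exists (p y) => h; rewrite j_gen.
have /bounded_linearP[lj _] := j_bounded tt.
apply/bounded_linearP; split=> [c h k|].
  by apply: j_inj; rewrite lj !j_gen /tens tens_lin.
exists (nrm (p y)) => [|h]; first exact: nrm_ge0.
by rewrite -nrm_j j_gen nrm_tens.
Qed.

Let corner_total :
  closure (linear_span [set f | exists X h, pullback j X /\ f = X h]) = [set: K].
Proof.
apply/seteqP; split=> // f _.
have := hgen_total iota; rewrite -subTset => /(_ f I).
apply: closureS; apply: linear_span_subset => _ [[y h] ->].
by exists (gen y), h; split.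
Qed.

Let D : opspace B K := pullback_opspace j_bounded (z := fun _ : 'I_1 => tt)
  frame1 corner_total.

Let F := opmod_vnm D.

Let S (y : E) : F := @opmod_of R H B K D (gen y) (gen_pullback y).

Let vec_of (X : opmod D) : {y : E | forall h, j tt (op X h) = tens y h}.
Proof. by apply: cid; have [_ /(_ tt)] := opP X. Qed.

Let Sadj (X : F) : E := p (sval (vec_of X)).

Let S_adjP x (Y : F) : ip (S x) Y = ip x (Sadj Y).
Proof.
apply: vna_ext => h k; rewrite -op_dot /Sadj; case: vec_of => y yY /=.
by rewrite dotE j_gen yY it_dot -p_sa.
Qed.

(** F is p E realized as operators from H into the closure of p E (x) H: S sends y to L_(p y) and
    its adjoint sends an operator included as L_y to p y. *)
Lemma corner_module : exists (F : vonNeumannModule B) (S : adjointable E F),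
  coisometry S /\ forall x, adj S (S x) = p x.
Proof.
exists F, (Adjointable S_adjP); split=> [Y|x] /=; rewrite /Sadj; case: vec_of => y yY /=.
  (* Tested against generators p x (x) k, which absorb [p], the vectors [y] and p y give the same
     operator. *)
  apply: op_inj => h; apply: (total_vec (hgen_total iota)) => _ [[x k] ->].
  rewrite !dotE yY j_gen -/(gen x k) j_gen !it_dot.
  by rewrite p_idem p_sa p_idem -p_sa.
have -> : y = p x.
  by apply: (@tens_inj _ _ _ _ (vnm_tensor E)) => h; rewrite -[RHS]j_gen -[LHS]yY.
exact: p_idem.
Qed.

End Corner.

(** * The Stinespring construction *)

Lemma total_agree2 (R : realType) (K K1 K2 : hilbertType R) (S : set K)
    (P P' : K -> K1) (Q Q' : K -> K2) :
  closure (linear_span S) = [set: K] ->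
  bounded_linear P -> bounded_linear P' -> bounded_linear Q -> bounded_linear Q' ->
  (forall s s', S s -> S s' -> hdot (P s) (P' s') = hdot (Q s) (Q' s')) ->
  forall f g, hdot (P f) (P' g) = hdot (Q f) (Q' g).
Proof.
move=> totS bP bP' bQ bQ' PQ f g.
rewrite hdotC [RHS]hdotC; congr (_^*).
apply: (total_agree totS bP bQ) => s Ss; rewrite hdotC [RHS]hdotC; congr (_^*).
by apply: (total_agree totS bP' bQ') => s' Ss'; exact: PQ.
Qed.

(** The source of the defect terms for [gram_extension]: inserted between a^* and b, the identity
    bounds Phi(x) by |x| and pi(a) by |a|. *)
Lemma cstar_complement (R : realType) (A : cstarAlgType R) (c : A) :
  exists2 r, star r = r & star c ** c + r ** r = (nrm c ^+ 2)%:C%C *: cone.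
Proof.
have [c0|c0] := eqVneq (nrm c) 0.
  exists 0; first exact: star0.
  by rewrite (nrm_eq0 c0) !cmul0r nrm0 expr0n scale0r addr0.
have nc0 : 0 < nrm c by rewrite lt_def c0 nrm_ge0.
pose d := ((nrm c)^-1)%:C%C *: c.
have [|w [sw _ ww _]] := ford_sqrt (star_cstar d).
  by rewrite nrm_cstar nrmZr ger0_norm ?invr_ge0 ?nrm_ge0 // mulVf // expr1n.
exists ((nrm c)%:C%C *: (cone - w)); first by apply/scale_sa/sub_cone_sa.
have -> : star c ** c = (nrm c ^+ 2)%:C%C *: (star d ** d).
  rewrite /d starZr cmulZl cmulZr !scale_realM -[LHS]scale_real1.
  by congr (_%:C%C *: _); field.
by rewrite scale_sq ww scalerBr addrC subrK.
Qed.

(** * The induced action on the coefficient algebra *)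

Section InducedAction.
Variables (R : realType) (A : cstarAlgType R) (G : topologicalGroupType).
Variables (E : preHilbertModType A) (eta : G -> E -> E).
Hypothesis eta_dyn : dynamical_system eta.
Variables (n : nat) (z : 'I_n -> E).
Hypothesis z_frame : \sum_i ip (z i) (z i) = cone.

Notation alpha := (induced_action eta).

(** The frame turns density of the span of inner products into an exact finite expansion, so linear
    identities for alpha and tau need only be checked on inner products, without a limit. *)
Lemma frame_expand (a : A) : a = \sum_i ip (z i) (ract (z i) a).
Proof.
rewrite -[LHS]cmul1l -z_frame cmul_suml; apply: eq_bigr => i _.
by rewrite ip_ract.
Qed.

Lemma alpha_ip t x y : alpha t (ip x y) = ip (eta t x) (eta t y).
Proof. by have [_] := induced_actionP t eta_dyn. Qed.

Lemma alpha_hom t : star_hom (alpha t).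
Proof. by have [] := induced_actionP t eta_dyn. Qed.

Lemma alpha_lin t : linear (alpha t).
Proof. by have [] := alpha_hom t. Qed.

Lemma alphaM t a b : alpha t (a ** b) = alpha t a ** alpha t b.
Proof. by have [_ ->] := alpha_hom t. Qed.

Lemma alpha_star t a : alpha t (star a) = star (alpha t a).
Proof. by have [_ _ ->] := alpha_hom t. Qed.

Lemma eta_mul s t x : eta (s * t)%g x = eta s (eta t x).
Proof. by case: eta_dyn. Qed.

Lemma eta1 x : eta 1%g x = x.
Proof.
have [/(_ 1%g)[eta' [etaK _ _ _]] _ _] := eta_dyn.
by apply: (can_inj etaK); rewrite -eta_mul mulg1.
Qed.

Lemma etaK t x : eta t^-1%g (eta t x) = x.
Proof. by rewrite -eta_mul mulVg eta1. Qed.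

Lemma etaKV t x : eta t (eta t^-1%g x) = x.
Proof. by rewrite -eta_mul mulgV eta1. Qed.

Lemma eta_ract t x a : eta t (ract x a) = ract (eta t x) (alpha t a).
Proof.
apply: ip_ext => y; rewrite -(etaKV t y) ip_ract -!alpha_ip ip_ract.
exact: alphaM.
Qed.

Lemma alpha_mul s t a : alpha (s * t)%g a = alpha s (alpha t a).
Proof.
rewrite (frame_expand a) !(linear_sum_fun _ _ (alpha_lin _)).
by apply: eq_bigr => i _; rewrite !alpha_ip !eta_mul.
Qed.

Lemma alpha1 a : alpha 1%g a = a.
Proof.
rewrite [in RHS](frame_expand a) {1}(frame_expand a) (linear_sum_fun _ _ (alpha_lin _)).
by apply: eq_bigr => i _; rewrite alpha_ip !eta1.
Qed.

(** [star_hom] does not include preservation of the unit; surjectivity of [alpha t] forces it. *)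
Lemma alpha_cone t : alpha t cone = cone.
Proof.
have e : alpha t (alpha t^-1%g cone) = cone by rewrite -alpha_mul mulgV alpha1.
by rewrite -{2}e -[alpha t^-1%g cone]cmul1l alphaM e cmul1r.
Qed.

End InducedAction.

Section UnitaryHom.
Variables (R : realType) (A : cstarAlgType R) (G : topologicalGroupType).
Variable u : G -> A.
Hypothesis u_hom : unitary_hom u.

Lemma unitary_hom1 : u 1%g = cone.
Proof.
have [/(_ 1%g)[uu _] um] := u_hom.
by rewrite -[LHS]cmul1l -uu -cmulA -um mulg1.
Qed.

Lemma unitary_homV t : u t^-1%g = star (u t).
Proof.
have [/(_ t)[uu _] um] := u_hom.
by rewrite -[LHS]cmul1l -uu -cmulA -um mulgV unitary_hom1 cmul1r.
Qed.

End UnitaryHom.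

Section Stinespring.
Variables (R : realType) (A : cstarAlgType R).
Variables (H : hilbertType R) (B : vonNeumannAlgebra H).
Variables (G : topologicalGroupType) (E : hilbertModType A) (eta : G -> E -> E).
Hypothesis eta_dyn : dynamical_system eta.
Variables (n : nat) (z : 'I_n -> E).
Hypothesis z_frame : \sum_i ip (z i) (z i) = cone.
Variables (top : unitary_topology) (M : vonNeumannModule B).
Variable w : G -> adjointable M M.
Hypothesis w_rep : unitary_rep top w.
Variable u : G -> B.
Hypothesis u_hom : unitary_hom u.
Variable tau : A -> B.
Hypothesis tau_lin : linear tau.
Variable T : E -> M.
Hypothesis T_tau : tau_map tau T.
Hypothesis T_cov : forall t x, T (eta t x) = ract (w t (T x)) (star (u t)).

Notation alpha := (induced_action eta).
Notation KM := (it_space (vnm_tensor M)).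

(** Covariance of tau is inherited from T on inner products: the unitary [w t] cancels there, and
    [u t] comes out on both sides. *)
Lemma tau_alpha t a : tau (alpha t a) = u t ** tau a ** star (u t).
Proof.
have [/(_ t)[wl wr] _ _] := w_rep.
rewrite {1}(frame_expand z_frame a) (linear_sum_fun _ _ (alpha_lin eta_dyn t)).
rewrite [in RHS](frame_expand z_frame a) !(linear_sum_fun _ _ tau_lin).
rewrite cmul_sumr cmul_suml; apply: eq_bigr => i _.
rewrite alpha_ip // -T_tau !T_cov ip_ract ip_ractl starK -T_tau.
by rewrite adjP wl.
Qed.

(* A (x) H with the inner product given by [tau], embedded in the n-th power of
   M (x) H by means of the frame. *)
Let iota (ah : A * H) (i : 'I_n) : KM := tens (T (ract (z i) ah.1)) ah.2.

Let K : hilbertType R := hspan iota.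

Let gen (a : A) (h : H) : K := hgen iota (a, h).

Let K_total : closure (linear_span [set f | exists ah, f = gen ah.1 ah.2]) = [set: K].
Proof.
rewrite -[RHS](hgen_total iota); congr (closure (linear_span _)).
by apply/seteqP; split=> [_ [[a h] ->]|_ [[a h] ->]]; exists (a, h).
Qed.

(** The frame collapses the sum over the components, leaving the Stinespring form, which no longer
    depends on the frame. *)
Let dot_gen a h b k : hdot (gen a h) (gen b k) = hdot h (vna_op (tau (star a ** b)) k).
Proof.
rewrite hdot_hspan [in RHS](frame_expand z_frame b) cmul_sumr (linear_sum_fun _ _ tau_lin).
rewrite vna_op_sum hdot_sumr; apply: eq_bigr => i _.
by rewrite !hcomp_gen it_dot T_tau ip_ractl.
Qed.

Let K_ext (f g : K) : (forall a h, hdot (gen a h) f = hdot (gen a h) g) -> f = g.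
Proof. by move=> fg; apply: (total_vec K_total) => _ [ah ->]. Qed.

Let op_ext (U : hilbertType R) (P Q : K -> U) : bounded_linear P -> bounded_linear Q ->
  (forall a h, P (gen a h) = Q (gen a h)) -> P =1 Q.
Proof. by move=> bP bQ PQ; apply: (total_ext K_total bP bQ) => _ [ah ->]. Qed.

Let op_agree2 (K1 K2 : hilbertType R) (P P' : K -> K1) (Q Q' : K -> K2) :
  bounded_linear P -> bounded_linear P' -> bounded_linear Q -> bounded_linear Q' ->
  (forall a h b k, hdot (P (gen a h)) (P' (gen b k)) = hdot (Q (gen a h)) (Q' (gen b k))) ->
  forall f g, hdot (P f) (P' g) = hdot (Q f) (Q' g).
Proof.
move=> bP bP' bQ bQ' PQ; apply: (total_agree2 K_total) => // _ _ [ah ->] [bk ->].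
exact: PQ.
Qed.

Let gen_lin a : linear (gen a).
Proof.
by move=> c h k; apply: K_ext => b l; rewrite hdot_linear !dot_gen vna_op_lin hdot_linear.
Qed.

Let gen_linl h : linear (fun a => gen a h).
Proof.
move=> c a b; apply: K_ext => d k; rewrite hdot_linear !dot_gen.
by rewrite cmulDr cmulZr tau_lin vna_opD vna_opZ hdot_linear.
Qed.

Let gen_bounded a : bounded_linear (gen a).
Proof.
apply/bounded_linearP; split; first exact: gen_lin.
exists (Num.sqrt (nrm (tau (star a ** a)))); first exact: sqrtr_ge0.
exact: (gram_nrm_le (dot_gen a ^~ a)).
Qed.

(** With <x, x> = c^* c and r^2 = |x|^2 - <x, x>, the defect of T(x a) (x) h is the generator r a
    (x) h of K itself. *)
Let Phi_ex x : exists Phi : K -> KM, [/\ linear Phi,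
  forall f, nrm (Phi f) <= nrm x * nrm f &
  forall a h, Phi (gen a h) = tens (T (ract x a)) h].
Proof.
have [c cE] := ip_pos x.
have nc : nrm c = nrm x.
  by apply/eqP; rewrite -(@eqrXn2 _ 2) ?nrm_ge0 // -nrm_cstar -cE nrm_ip.
have [r sr rc] := cstar_complement c.
have [||Phi [lPhi bPhi PhiE]] := @gram_extension R K KM K (A * H)
  (fun ah => gen ah.1 ah.2) (fun ah => tens (T (ract x ah.1)) ah.2)
  (fun ah => gen (r ** ah.1) ah.2) (nrm x) (nrm_ge0 x).
- exact: K_total.
- move=> [a h] [b k] /=; rewrite it_dot T_tau ip_ractl ip_ract !dot_gen.
  rewrite -hdotDr -vna_opD -(linearD_fun _ _ tau_lin) -nc.
  have -> : star a ** (ip x x ** b) + star (r ** a) ** (r ** b) =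
      (nrm c ^+ 2)%:C%C *: (star a ** b).
    rewrite starM sr -[star a ** r ** _]cmulA (cmulA r) -cmulDr -cmulDl cE rc.
    by rewrite cmulZl cmul1l cmulZr.
  by rewrite (linearZ_fun _ _ tau_lin) vna_opZ hdotZr.
- by exists Phi; split=> // a h; rewrite (PhiE (a, h)).
Qed.

Let Phi x := sval (cid (Phi_ex x)).

Let Phi_gen x a h : Phi x (gen a h) = tens (T (ract x a)) h.
Proof. by rewrite /Phi; case: cid => f []. Qed.

Let nrm_Phi x f : nrm (Phi x f) <= nrm x * nrm f.
Proof. by rewrite /Phi; case: cid => g []. Qed.

Let Phi_bounded x : bounded_linear (Phi x).
Proof.
apply/bounded_linearP; split; first by rewrite /Phi; case: cid => f [].
by exists (nrm x); [exact: nrm_ge0 | exact: nrm_Phi].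
Qed.

Let Pi_ex a : exists P : K -> K, [/\ linear P,
  forall f, nrm (P f) <= nrm a * nrm f &
  forall b h, P (gen b h) = gen (a ** b) h].
Proof.
have [r sr ra] := cstar_complement a.
have [||P [lP bP PE]] := @gram_extension R K K K (A * H)
  (fun ah => gen ah.1 ah.2) (fun ah => gen (a ** ah.1) ah.2)
  (fun ah => gen (r ** ah.1) ah.2) (nrm a) (nrm_ge0 a).
- exact: K_total.
- move=> [b h] [d k] /=; rewrite !dot_gen.
  rewrite -hdotDr -vna_opD -(linearD_fun _ _ tau_lin).
  have -> : star (a ** b) ** (a ** d) + star (r ** b) ** (r ** d) =
      (nrm a ^+ 2)%:C%C *: (star b ** d).
    rewrite !starM sr -!(cmulA (star b)) (cmulA (star a)) (cmulA r) -cmulDr -cmulDl ra.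
    by rewrite cmulZl cmul1l cmulZr.
  by rewrite (linearZ_fun _ _ tau_lin) vna_opZ hdotZr.
- by exists P; split=> // b h; rewrite (PE (b, h)).
Qed.

Let Pi a := sval (cid (Pi_ex a)).

Let Pi_gen a b h : Pi a (gen b h) = gen (a ** b) h.
Proof. by rewrite /Pi; case: cid => f []. Qed.

Let Pi_bounded a : bounded_linear (Pi a).
Proof.
apply/bounded_linearP; split; first by rewrite /Pi; case: cid => f [].
by exists (nrm a); [exact: nrm_ge0 | rewrite /Pi; case: cid => f []].
Qed.

Let Ups_ex t : exists P : K -> K, [/\ linear P,
  forall f, nrm (P f) <= 1 * nrm f &
  forall b h, P (gen b h) = gen (alpha t b) (vna_op (u t) h)].
Proof.
have [/(_ t)[uu _] _] := u_hom.
(* The prescribed map preserves the Gram matrix by [tau_alpha], so the defect is 0 and the bound is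
   1. *)
have [||P [lP bP PE]] := @gram_extension R K K K (A * H)
  (fun ah => gen ah.1 ah.2) (fun ah => gen (alpha t ah.1) (vna_op (u t) ah.2))
  (fun ah => 0) 1 ler01.
- exact: K_total.
- move=> [a h] [b k] /=; rewrite !dot_gen hdot0r addr0 expr1n mul1r.
  rewrite -(alpha_star eta_dyn) -(alphaM eta_dyn) tau_alpha -vna_op_starr -!vna_opM.
  by rewrite !cmulA uu cmul1l -cmulA uu cmul1r.
- by exists P; split=> // b h; rewrite (PE (b, h)).
Qed.

Let Ups t := sval (cid (Ups_ex t)).

Let Ups_gen t b h : Ups t (gen b h) = gen (alpha t b) (vna_op (u t) h).
Proof. by rewrite /Ups; case: cid => f []. Qed.

Let Ups_bounded t : bounded_linear (Ups t).
Proof.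
apply/bounded_linearP; split; first by rewrite /Ups; case: cid => f [].
by exists 1; [exact: ler01 | rewrite /Ups; case: cid => f []].
Qed.

Let Pi_adj a f g : hdot (Pi a f) g = hdot f (Pi (star a) g).
Proof.
apply: (op_agree2 (Pi_bounded a) (@bounded_linear_id _ K) (@bounded_linear_id _ K)
  (Pi_bounded (star a))) => b h d k.
by rewrite !Pi_gen !dot_gen starM cmulA.
Qed.

Let Ups_adj t f g : hdot (Ups t f) g = hdot f (Ups t^-1%g g).
Proof.
apply: (op_agree2 (Ups_bounded t) (@bounded_linear_id _ K) (@bounded_linear_id _ K)
  (Ups_bounded t^-1%g)) => b h d k.
have [/(_ t)[uu uu'] _] := u_hom.
rewrite !Ups_gen !dot_gen.
have -> : star b ** alpha t^-1%g d = alpha t^-1%g (star (alpha t b) ** d).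
  rewrite (alphaM eta_dyn) (alpha_star eta_dyn) -(alpha_mul eta_dyn z_frame).
  by rewrite mulVg (alpha1 eta_dyn z_frame).
rewrite tau_alpha (unitary_homV u_hom) starK -vna_op_starr -!vna_opM.
by rewrite -!cmulA uu' cmul1r.
Qed.

Let Ups_mul s t f : Ups (s * t)%g f = Ups s (Ups t f).
Proof.
apply: (op_ext (Ups_bounded _) (bounded_linear_comp (Ups_bounded t) (Ups_bounded s))).
move=> a h /=; rewrite !Ups_gen (alpha_mul eta_dyn z_frame).
by have [_ ->] := u_hom; rewrite vna_opM.
Qed.

Let Ups1 f : Ups 1%g f = f.
Proof.
apply: (op_ext (Ups_bounded _) (@bounded_linear_id _ K)) => a h.
by rewrite Ups_gen (alpha1 eta_dyn z_frame) (unitary_hom1 u_hom) vna_op1.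
Qed.

Let Phi_Pi x a f : Phi x (Pi a f) = Phi (ract x a) f.
Proof.
apply: (op_ext (bounded_linear_comp (Pi_bounded a) (Phi_bounded x)) (Phi_bounded _)).
by move=> b h /=; rewrite Pi_gen !Phi_gen ractM.
Qed.

(** The intertwining Psi(x) v_t = w_t Psi(eta_t^-1 x) in weak form: [w t] acts on M and not on M (x)
    H, so its adjoint is moved to the test vector. [Ups_tens] recovers the strong form on F. *)
Let Phi_Ups t x f y k :
  hdot (tens y k) (Phi x (Ups t f)) = hdot (tens (adj (w t) y) k) (Phi (eta t^-1%g x) f).
Proof.
apply: (total_agree K_total
  (bounded_linear_comp (Ups_bounded t) (Phi_bounded x)) (Phi_bounded _)).
move=> _ [[a h] ->] /=; rewrite Ups_gen !Phi_gen.
have -> : ract x (alpha t a) = eta t (ract (eta t^-1%g x) a).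
  by rewrite (eta_ract eta_dyn) (etaKV eta_dyn).
rewrite T_cov /tens tens_ract -vna_opM.
have [/(_ t)[-> _] _] := u_hom; rewrite vna_op1 !it_dot.
by rewrite adjPl.
Qed.

(** The coordinates of K are the operators Phi(z_i), hence control of all Phi(z_i) f is control of
    the norm of f. *)
Let hcomp_Phi i f : hcomp i f = Phi (z i) f.
Proof.
apply: (op_ext (hcomp_bounded iota i) (Phi_bounded (z i))) => a h.
by rewrite hcomp_gen Phi_gen.
Qed.

Let K_frame (f g : K) : hdot f g = \sum_i hdot (Phi (z i) f) (Phi (z i) g).
Proof. by rewrite hdot_hspan; apply: eq_bigr => i _; rewrite !hcomp_Phi. Qed.

Let gen_pullback a : pullback Phi (gen a).
Proof.
split; first exact: gen_bounded.
by move=> x; exists (T (ract x a)) => h; rewrite Phi_gen.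
Qed.

Let D_total :
  closure (linear_span [set f | exists X h, pullback Phi X /\ f = X h]) = [set: K].
Proof.
apply/seteqP; split=> // f _.
have := K_total; rewrite -subTset => /(_ f I).
apply: closureS; apply: linear_span_subset => _ [[a h] ->].
by exists (gen a), h; split.
Qed.

Let D : opspace B K := pullback_opspace Phi_bounded K_frame D_total.

Let F := opmod_vnm D.

Let Pi_pullback a (X : opmod D) : os_set D (Pi a \o op X).
Proof.
have [bX Xj] := opP X; split; first exact: bounded_linear_comp bX (Pi_bounded a).
move=> x; have [y yX] := Xj (ract x a).
by exists y => h; rewrite /= Phi_Pi yX.
Qed.

Let pi_map a (X : F) : F := opmod_of (Pi_pullback a X).

Let pi_adjP a (X Y : F) : ip (pi_map a X) Y = ip X (pi_map (star a) Y).
Proof.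
by apply: vna_ext => h k; rewrite -!op_dot /= Pi_adj.
Qed.

Let pi a : adjointable F F := Adjointable (pi_adjP a).

Let vec_ex x (X : opmod D) : exists y : M, forall h, Phi x (op X h) = tens y h.
Proof. by have [_ /(_ x)] := opP X. Qed.

(** The chosen vector is unique, since an element of M is determined by its operator ([M_ext]). *)
Let Psi x (X : F) : M := sval (cid (vec_ex x X)).

Let PsiE x (X : opmod D) h : tens (Psi x X) h = Phi x (op X h).
Proof. by rewrite /Psi; case: cid. Qed.

Let Ups_tens t x (X : opmod D) h :
  Phi x (Ups t (op X h)) = tens (w t (Psi (eta t^-1%g x) X)) h.
Proof.
apply: (@tens_ext _ _ _ _ (vnm_tensor M)) => y k.
by rewrite Phi_Ups -PsiE !it_dot adjPl.
Qed.

Let Ups_pullback t (X : opmod D) : os_set D (Ups t \o op X).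
Proof.
have [bX Xj] := opP X; split; first exact: bounded_linear_comp bX (Ups_bounded t).
by move=> x; exists (w t (Psi (eta t^-1%g x) X)) => h; rewrite /= Ups_tens.
Qed.

Let v_map t (X : F) : F := opmod_of (Ups_pullback t X).

Let v_adjP t (X Y : F) : ip (v_map t X) Y = ip X (v_map t^-1%g Y).
Proof.
by apply: vna_ext => h k; rewrite -!op_dot /= Ups_adj.
Qed.

Let v t : adjointable F F := Adjointable (v_adjP t).

Let V_map (b : regular_mod B) : F := opmod_of (os_ract (b : B) (gen_pullback cone : os_set D _)).

Let V_adj (X : F) : regular_mod B := ip (V_map cone) X.

Let V_adjP b X : ip (V_map b) X = ip b (V_adj X).
Proof.
apply: vna_ext => h k; rewrite -op_dot /= vna_opM vna_op_starr /V_adj -op_dot /=.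
by rewrite vna_op1.
Qed.

Let V : adjointable (regular_mod B) F := Adjointable V_adjP.

Let Pi_lin (c : complex R) a b f : Pi (c *: a + b) f = c *: Pi a f + Pi b f.
Proof.
apply: (op_ext (Pi_bounded _) (bounded_linear_comb c (Pi_bounded a) (Pi_bounded b))).
by move=> d h; rewrite !Pi_gen cmulDl cmulZl gen_linl.
Qed.

Let pi_rep : star_rep pi.
Proof.
split=> [f c a b|a b f|//]; apply: op_inj => h; first by rewrite opD opZ /= Pi_lin.
apply: (op_ext (Pi_bounded _) (bounded_linear_comp (Pi_bounded b) (Pi_bounded a))).
by move=> d k /=; rewrite !Pi_gen cmulA.
Qed.

Let pi_covariant t a f : pi (alpha t a) f = v t (pi a (adj (v t) f)).
Proof.
apply: op_inj => h /=; move: (op f h) => g.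
apply: (op_ext (Pi_bounded _) (bounded_linear_comp (bounded_linear_comp
  (Ups_bounded t^-1%g) (Pi_bounded a)) (Ups_bounded t))) => b k /=.
rewrite Ups_gen !Pi_gen Ups_gen (alphaM eta_dyn) -(alpha_mul eta_dyn z_frame).
by rewrite -vna_opM -u_hom.2 mulgV (alpha1 eta_dyn z_frame) (unitary_hom1 u_hom) vna_op1.
Qed.

Let v_unitary t : unitary_adj (v t).
Proof.
by split=> X; apply: op_inj => h /=; rewrite -Ups_mul ?mulVg ?mulgV Ups1.
Qed.

(** Additivity is a consequence of [tau_map]: the vector [d] is orthogonal to every value of T and
    is itself a combination of such values. *)
Let T_sub x y : T (x - y) = T x - T y.
Proof.
apply/eqP; rewrite -subr_eq0; apply/eqP/ip_eq0; set d := T (x - y) - _.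
have Td a : ip (T a) d = 0.
  by rewrite !ipBr !T_tau ipBr (linearB_fun _ _ tau_lin) subrr.
by rewrite {1}/d !ipBl !Td !subr0.
Qed.

Let Phi_sub x y f : Phi (x - y) f = Phi x f - Phi y f.
Proof.
rewrite [RHS]addrC -[- Phi y f]scaleN1r.
apply: (op_ext (Phi_bounded _) (bounded_linear_comb (-1) (Phi_bounded y) (Phi_bounded x))).
move=> a h; rewrite scaleN1r [RHS]addrC !Phi_gen.
have -> : ract (x - y) a = ract x a - ract y a.
  by rewrite -[- y]scaleN1r ractDl ractZl scaleN1r.
by rewrite T_sub /tens tensBl.
Qed.

Let nrm_w_tens t y h : nrm (tens (w t y) h) = nrm (tens y h).
Proof.
have [/(_ t)[wl _] _ _] := w_rep.
apply/eqP; rewrite -(@eqrXn2 _ 2) ?nrm_ge0 //; apply/eqP; apply: complexI.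
by rewrite -!hdot_nrm !it_dot adjP wl.
Qed.

(* On the frame the group [v] is intertwined with [w], so that its continuity
   is inherited from that of [w] and [eta]. *)
Let Ups_diff t s i (X : opmod D) h :
  nrm (hcomp i (Ups t (op X h) - Ups s (op X h))) <=
  nrm (eta t^-1%g (z i) - eta s^-1%g (z i)) * nrm (op X h) +
  nrm (tens (w t (Psi (eta s^-1%g (z i)) X)) h - tens (w s (Psi (eta s^-1%g (z i)) X)) h).
Proof.
rewrite (linearB_fun _ _ (hcomp_linear i)) !hcomp_Phi !Ups_tens.
apply: (le_trans (nrm_sub_trans (tens (w t (Psi (eta s^-1%g (z i)) X)) h) _ _)).
rewrite lerD2r /tens -tensBl -(linearB_fun _ _ (adjointable_linear (w t))).
by rewrite -/(tens _ h) nrm_w_tens /tens tensBl -!/(tens _ h) !PsiE -Phi_sub nrm_Phi.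
Qed.

Let eta_near s i (e : R) : 0 < e ->
  \forall t \near s, nrm (eta t^-1%g (z i) - eta s^-1%g (z i)) < e.
Proof.
move=> e0; have [_ _ /(_ (z i)) cz] := eta_dyn.
have ci : (fun t => eta t^-1%g (z i)) @ s --> eta s^-1%g (z i).
  exact: (@continuous_comp _ _ _ (fun t : G => t^-1%g) (fun t => eta t (z i)) s
    (invg_continuous s) (cz s^-1%g)).
by have /near_nrm/(_ e e0) := ci; apply: filterS => t; rewrite nrmC.
Qed.

Let v_strong : strong_continuous w -> strong_continuous v.
Proof.
move=> cw X h s; apply/near_nrm => e e0.
(* Each component is at most (e / r)(|X h| + 1), and passing to the norm of K costs a factor n; the
   final 1 makes r positive and the estimate strict. *)
pose r := n%:R * (nrm (op X h) + 1) + 1.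
have r0 : 0 < r by rewrite ltr_wpDl // mulr_ge0 // addr_ge0 // nrm_ge0.
have er : 0 < e / r by rewrite divr_gt0.
have wn i : \forall t \near s,
    nrm (tens (w t (Psi (eta s^-1%g (z i)) X)) h - tens (w s (Psi (eta s^-1%g (z i)) X)) h) < e / r.
  have /near_nrm/(_ _ er) := cw (Psi (eta s^-1%g (z i)) X) h s.
  by apply: filterS => t; rewrite nrmC.
have all1 : \forall t \near s, forall i,
    nrm (eta t^-1%g (z i) - eta s^-1%g (z i)) < e / r.
  by apply: filter_forall => i; exact: eta_near.
have all2 : \forall t \near s, forall i,
    nrm (tens (w t (Psi (eta s^-1%g (z i)) X)) h - tens (w s (Psi (eta s^-1%g (z i)) X)) h) < e / r.
  by apply: filter_forall => i; exact: wn.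
apply: filterS2 all1 all2 => t t1 t2; rewrite nrmC.
have bnd i : nrm (hcomp i (Ups t (op X h) - Ups s (op X h))) <= e / r * (nrm (op X h) + 1).
  apply: (le_trans (Ups_diff t s i X h)); rewrite mulrDr mulr1 lerD //; last exact/ltW/t2.
  by rewrite ler_wpM2r ?nrm_ge0 // ltW // t1.
have c0 : 0 <= e / r * (nrm (op X h) + 1) by rewrite mulr_ge0 ?(ltW er) // addr_ge0 ?nrm_ge0.
apply: (le_lt_trans (hspan_norm_le c0 bnd)).
have -> : n%:R * (e / r * (nrm (op X h) + 1)) = e * (r - 1) / r by rewrite /r; ring.
by rewrite ltr_pdivrMr // ltr_pM2l //; lra.
Qed.

Let nrm_op (X : opmod D) h : nrm (op X h) <= nrm X * nrm h.
Proof. exact: (@nrm_tens _ _ _ _ (vnm_tensor F) X h). Qed.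

Let nrm_Psi x X : nrm (Psi x X) <= nrm x * nrm X.
Proof.
apply: (@nrm_le_tens _ _ _ _ (vnm_tensor M)) => [|h]; first by rewrite mulr_ge0 ?nrm_ge0.
rewrite -/(tens _ h) PsiE -mulrA; apply: (le_trans (nrm_Phi _ _)).
by rewrite ler_wpM2l ?nrm_ge0 // nrm_op.
Qed.

Let v_norm : Defs.norm_continuous w -> Defs.norm_continuous v.
Proof.
move=> cw s e e0; rewrite (ge0_complexRe (ltW e0)).
have {e0} : 0 < complex.Re e by rewrite -ltcR -(ge0_complexRe (ltW e0)).
move: (complex.Re e) => {}e e0.
(* [c] bounds the norms of all Psi(eta_s^-1 z_i), which makes the estimate uniform over the unit
   ball of F. *)
pose N i := nrm (eta s^-1%g (z i)); pose c := \sum_i N i.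
have N0 i : 0 <= N i by exact: nrm_ge0.
have c0 : 0 <= c by exact: sumr_ge0.
have Nc i : N i <= c by rewrite /c (bigD1 i) //= lerDl sumr_ge0.
pose r := n%:R * (1 + c) + 1.
have r0 : 0 < r by rewrite ltr_wpDl // mulr_ge0 // addr_ge0.
have er : 0 < e / r by rewrite divr_gt0.
have erC : 0 < (e / r)%:C%C :> complex R by rewrite ltcR.
have all1 : \forall t \near s, forall i,
    nrm (eta t^-1%g (z i) - eta s^-1%g (z i)) < e / r.
  by apply: filter_forall => i; exact: eta_near.
apply: filterS2 all1 (cw s _ erC) => t t1 t2 X.
rewrite !nrmE -rmorphM lecR.
apply: (@nrm_le_tens _ _ _ _ (vnm_tensor F)) => [|h]; first by rewrite mulr_ge0 ?nrm_ge0 ?ltW.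
pose q := nrm X * nrm h; have q0 : 0 <= q by rewrite mulr_ge0 ?nrm_ge0.
have bnd i : nrm (hcomp i (Ups t (op X h) - Ups s (op X h))) <= e / r * (1 + c) * q.
  apply: (le_trans (Ups_diff t s i X h)); rewrite mulrDr mulrDl mulr1 lerD //.
    by rewrite ler_pM ?nrm_ge0 ?nrm_op // ltW // t1.
  set y := Psi _ X; have := t2 y; rewrite !nrmE -rmorphM lecR => wy.
  rewrite /tens -tensBl; apply: (le_trans (nrm_tens _ _ _)).
  rewrite /q mulrA ler_wpM2r ?nrm_ge0 //; apply: (le_trans wy).
  rewrite -mulrA ler_wpM2l ?(ltW er) //; apply: (le_trans (nrm_Psi _ _)).
  by rewrite ler_wpM2r ?nrm_ge0 // Nc.
have b0 : 0 <= e / r * (1 + c) * q by rewrite mulr_ge0 // mulr_ge0 ?addr_ge0 // ltW.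
apply: (le_trans (hspan_norm_le b0 bnd)).
have -> : n%:R * (e / r * (1 + c) * q) = e * (r - 1) / r * q by rewrite /r; ring.
rewrite -[leRHS]mulrA -/q ler_wpM2r //.
by rewrite ler_pdivrMr // ler_pM2l //; lra.
Qed.

Let v_rep : unitary_rep top v.
Proof.
have [_ _ cw] := w_rep.
split; [exact: v_unitary | by move=> s t X; apply: op_inj => h /=; rewrite Ups_mul |].
by case: (top) cw => [/v_norm | /v_strong].
Qed.

Let M_ext (x y : M) : (forall h, tens x h = tens y h) -> x = y.
Proof. by move=> xy; apply: (@tens_inj _ _ _ _ (vnm_tensor M)). Qed.

Let Phi_lin x : linear (Phi x).
Proof. by have /bounded_linearP[] := Phi_bounded x. Qed.

Let Psi_rlinear x : bounded_rlinear (Psi x).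
Proof.
split.
  apply/bounded_linearP; split=> [c X Y|].
    apply: M_ext => h; rewrite PsiE opD opZ Phi_lin.
    by rewrite /tens tensDl tensZl -!/(tens _ h) !PsiE.
  by exists (nrm x); [exact: nrm_ge0 | exact: nrm_Psi].
by move=> X b; apply: M_ext => h; rewrite PsiE /tens tens_ract -/(tens _ _) PsiE.
Qed.

Let Psi_associated : associated Psi pi.
Proof.
move=> x y X Y; apply: vna_ext => h k.
rewrite -(it_dot (vnm_tensor M)) -!/(tens _ _) !PsiE -op_dot /=.
apply: (op_agree2 (Phi_bounded y) (Phi_bounded x) (Pi_bounded _) (@bounded_linear_id _ K)).
move=> a h' b k'; rewrite !Phi_gen Pi_gen it_dot T_tau dot_gen.
by rewrite ip_ractl ip_ract starM ip_star cmulA.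
Qed.

Let Psi_covariant t x f : Psi (eta t x) f = w t (Psi x (adj (v t) f)).
Proof.
apply: M_ext => h; rewrite PsiE -[x in RHS](etaK eta_dyn t) -Ups_tens /=.
by rewrite -Ups_mul mulgV Ups1.
Qed.

Let V_tau (a : A) (b : B) : tau a ** b = adj V (pi a (V b)).
Proof.
apply: vna_ext => h k; rewrite /= /V_adj -op_dot /= vna_op1 Pi_gen dot_gen.
by rewrite star1 cmul1l cmul1r vna_opM.
Qed.

Let V_covariant t (b : B) : v t (V b) = V (u t ** b).
Proof.
by apply: op_inj => h /=; rewrite Ups_gen (alpha_cone eta_dyn z_frame) vna_opM.
Qed.

Let V_Psi x (b : B) : ract (T x) b = Psi x (V b).
Proof.
by apply: M_ext => h; rewrite PsiE /= Phi_gen ract1 /tens tens_ract.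
Qed.

(** M and [w] are themselves the target of Psi here; the passage from E' to M is left to the
    corner. *)
Lemma covariant_stinespring :
  exists (F : vonNeumannModule B) (pi : A -> adjointable F F)
         (v : G -> adjointable F F) (V : adjointable (regular_mod B) F)
         (Psi : E -> F -> M),
    [/\ covariant_rep top alpha pi v,
        forall (a : A) (b : B), tau a ** b = adj V (pi a (V b)),
        forall (t : G) (b : B), v t (V b) = V (u t ** b) &
        [/\ covariant_quasi_rep eta top Psi v w, associated Psi pi &
            forall (x : E) (b : B), ract (T x) b = Psi x (V b)]].
Proof.
exists F, pi, v, V, Psi; split=> //; split=> //.
by split=> //; split=> //; exists pi.
Qed.

End Stinespring.

(** * The unitary group compressed to the corner *)

Section CornerRepresentation.
Variables (R : realType) (C : cstarAlgType R).
Variables (H : hilbertType R) (B : vonNeumannAlgebra H) (G : topologicalGroupType).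
Variables (top : unitary_topology) (E F : vonNeumannModule B).
Variable pi : C -> adjointable E E.
Hypothesis pi_rep : star_rep pi.
Variable u : G -> C.
Hypothesis u_rep : cstar_unitary_rep top pi u.
Variable S : adjointable E F.
Hypothesis S_coiso : coisometry S.
Hypothesis adjSS : forall x, adj S (S x) = pi cone x.

Let piM a b x : pi a (pi b x) = pi (a ** b) x.
Proof. by have [_ ->] := pi_rep. Qed.

Let pi_adj a x : adj (pi a) x = pi (star a) x.
Proof. by have [_ _ ->] := pi_rep. Qed.

Let pi_sub a b x : pi (a - b) x = pi a x - pi b x.
Proof. by have [l _ _] := pi_rep; exact: (linearB_fun _ _ (l x)). Qed.

Let p_adjS y : pi cone (adj S y) = adj S y.
Proof. by rewrite -adjSS S_coiso. Qed.

Let nrm_S_tens y h : pi cone y = y -> nrm (tens (S y) h) = nrm (tens y h).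
Proof.
move=> py; apply/eqP; rewrite -(@eqrXn2 _ 2) ?nrm_ge0 //; apply/eqP; apply: complexI.
by rewrite -!hdot_nrm !it_dot adjP adjSS py.
Qed.

Let nrm_adjS y : nrm (adj S y) = nrm y.
Proof.
apply/eqP; rewrite -(@eqrXn2 _ 2) ?nrm_ge0 //; apply/eqP.
by rewrite -!nrm_ip -adjPl S_coiso.
Qed.

(** The representation may be non-unital: c^* c + r^2 = |c|^2 turns into |c|^2 pi(1) y, which is
    |c|^2 y because [y] lies in the corner. *)
Let nrm_pi c y h : pi cone y = y -> nrm (tens (pi c y) h) <= nrm c * nrm (tens y h).
Proof.
move=> py; have [r sr rc] := cstar_complement c.
have e : nrm (tens (pi c y) h) ^+ 2 + nrm (tens (pi r y) h) ^+ 2 =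
    nrm c ^+ 2 * nrm (tens y h) ^+ 2.
  apply: complexI; rewrite rmorphD [RHS]rmorphM /= -!hdot_nrm !it_dot -hdotDr -vna_opD.
  rewrite !adjP !pi_adj !piM -ipDr sr.
  have [l _ _] := pi_rep.
  rewrite -(linearD_fun _ _ (l y)) rc (linearZ_fun _ _ (l y)) py.
  by rewrite ipZr vna_opZ hdotZr.
rewrite -(@ler_pXn2r _ 2) ?nnegrE ?mulr_ge0 ?nrm_ge0 // exprMn -e lerDl.
exact: sqr_ge0.
Qed.

Definition corner_rep_map t (y : F) : F := S (pi (u t) (adj S y)).

Let corner_adjP t x y :
  ip (corner_rep_map t x) y = ip x (S (adj (pi (u t)) (adj S y))).
Proof. by rewrite adjP adjP -adjPl. Qed.

Definition corner_rep t : adjointable F F := Adjointable (corner_adjP t).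

Let corner_diff t s f h :
  nrm (tens (corner_rep t f) h - tens (corner_rep s f) h) =
  nrm (tens (pi (u t - u s) (adj S f)) h).
Proof.
rewrite /tens -tensBl /= /corner_rep_map.
rewrite -(linearB_fun _ _ (adjointable_linear S)) -pi_sub -/(tens _ _) nrm_S_tens //.
by rewrite piM cmul1l.
Qed.

Lemma corner_unitary_rep : unitary_rep top corner_rep.
Proof.
have [[u_unit uM] u_cont] := u_rep; split.
- move=> t; have [uu uu'] := u_unit t.
  by split=> x; rewrite /= /corner_rep_map adjSS !pi_adj !piM cmul1r ?uu ?uu' p_adjS S_coiso.
- by move=> s t f; rewrite /= /corner_rep_map adjSS !piM cmul1r uM.
case: (top) u_cont => cu.
- move=> s e e0; rewrite (ge0_complexRe (ltW e0)).
  have {e0} : 0 < complex.Re e by rewrite -ltcR -(ge0_complexRe (ltW e0)).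
  move: (complex.Re e) => {}e e0.
  have /near_nrm/(_ e e0) := cu s; apply: filterS => t ts f.
  rewrite !nrmE -rmorphM lecR.
  apply: (@nrm_le_tens _ _ _ _ (vnm_tensor F)) => [|h]; first by rewrite mulr_ge0 ?nrm_ge0 ?ltW.
  rewrite tensBl corner_diff; apply: (le_trans (nrm_pi _ _ (p_adjS f))).
  rewrite -mulrA -(nrm_adjS f) ler_pM ?nrm_ge0 ?nrm_tens //.
  by rewrite nrmC ltW.
- move=> f h s; apply/near_nrm => e e0.
  have /near_nrm/(_ e e0) := cu (adj S f) h s; apply: filterS => t.
  by rewrite corner_diff /tens -tensBl -pi_sub.
Qed.

Lemma corner_rep_S t y : corner_rep t (S y) = S (pi (u t) y).
Proof. by rewrite /= /corner_rep_map adjSS piM cmul1r. Qed.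

End CornerRepresentation.

Theorem theorem2p7 (R : realType) (A C : cstarAlgType R)
    (H : hilbertType R) (B : vonNeumannAlgebra H)
    (G : topologicalGroupType) (lcG : locally_compact [set: G])
    (top : unitary_topology)
    (E : hilbertModType A) (fullE : full E)
    (eta : G -> E -> E) (eta_dyn : dynamical_system eta)
    (E' : vonNeumannModule B)
    (pi' : C -> adjointable E' E') (pi'_rep : star_rep pi')
    (u : G -> B) (u_rep : vna_unitary_rep u)
    (u' : G -> C) (u'_rep : cstar_unitary_rep top pi' u')
    (tau : A -> B) (tau_cp : completely_positive tau)
    (T : E -> E') (T_tau : tau_map tau T)
    (T_cov : covariant_map eta pi' u' u T) :
  exists (F : vonNeumannModule B) (pi : A -> adjointable F F)
         (v : G -> adjointable F F) (V : adjointable (regular_mod B) F),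
    [/\ covariant_rep top (induced_action eta) pi v,
        forall (a : A) (b : B), tau a ** b = adj V (pi a (V b)),
        forall (t : G) (b : B), v t (V b) = V (u t ** b) &
        exists (F' : vonNeumannModule B) (Psi : E -> F -> F')
               (w : G -> adjointable F' F') (S : adjointable E' F'),
          [/\ covariant_quasi_rep eta top Psi v w,
              associated Psi pi,
              coisometry S,
              forall (x : E) (b : B), ract (T x) b = adj S (Psi x (V b)) &
              forall (t : G) (y : E'), w t (S y) = S (pi' (u' t) y)]].
Proof.
have [n [z z_frame]] := full_frame fullE.
have [u_hom _] := u_rep; have [u'_hom _] := u'_rep.
have [_ pi'M pi'_star] := pi'_rep.
have p_sa x y : ip (pi' cone x) y = ip x (pi' cone y).
  by rewrite adjP -pi'_star star1.
have p_idem x : pi' cone (pi' cone x) = pi' cone x by rewrite -pi'M cmul1l.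
have [F' [S [S_coiso adjSS]]] := corner_module p_sa p_idem.
(* Covariance at the neutral element reads T(x) = pi'(1) T(x), so T takes its values in the corner
   and nothing is lost by replacing it with S T. *)
have pT x : pi' cone (T x) = T x.
  have := T_cov 1%g x; rewrite (eta1 eta_dyn) (unitary_hom1 u'_hom) (unitary_hom1 u_hom).
  by rewrite star1 ract1.
pose w := corner_rep pi' u' S.
have w_rep : unitary_rep top w by exact: corner_unitary_rep.
have wS t y : w t (S y) = S (pi' (u' t) y) by exact: corner_rep_S.
pose T1 x := S (T x).
have T1_tau : tau_map tau T1.
  by move=> x y; rewrite /T1 adjP adjSS pT T_tau.
have T1_cov t x : T1 (eta t x) = ract (w t (T1 x)) (star (u t)).
  by rewrite /T1 wS T_cov adjointable_ract.
have [tau_lin _] := tau_cp.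
have [F [pi [v [V [Psi [rep tauE vV [qrep assoc TE]]]]]]] :=
  covariant_stinespring eta_dyn z_frame w_rep u_hom tau_lin T1_tau T1_cov.
exists F, pi, v, V; split=> //; exists F', Psi, w, S; split=> // x b.
by rewrite -TE /T1 -adjointable_ract adjSS adjointable_ract pT.
Qed.
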